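(* Let $k,\ell\in\mathbb Z$ with $k>\ell\ge0$, let $m_1,m_2\in\mathbb Z$, and let $\mu=\pm1$. (1) If $\ell\in\{0,1\}$, then $\Sigma(2^k,\mu2^\ell;m_1,m_2)=0$. Now assume $\ell\ge2$. (2) If $k-\ell\ge3$, then $$\Sigma(2^k,\mu2^\ell;m_1,m_2)=2^\ell\sum_{\substack{0\le i\le\ell-2\\ i\equiv\ell\,(2)}}\big(g_1(2^k,m_1,2^{k-i})g_1(2^\ell,m_2,2^{i+2})+(-\mu)g_{-1}(2^k,m_1,2^{k-i})g_{-1}(2^\ell,m_2,2^{i+2})\big).$$ (3) If $k-\ell=2$, then $$\Sigma(2^k,\mu2^\ell;m_1,m_2)=(-1)^\ell2^\ell\sum_{\substack{0\le i\le\ell-2\\ i\equiv\ell\,(2)}}\big(g_1(2^k,m_1,2^{k-i})g_1(2^\ell,m_2,2^{i+2})+(-\mu)g_{-1}(2^k,m_1,2^{k-i})g_{-1}(2^\ell,m_2,2^{i+2})\big).$$ (4) If $k-\ell=1$, then $$\Sigma(2^k,\mu2^\ell;m_1,m_2)=(-\mu)^\ell2^\ell\sum_{\substack{0\le i\le\ell-2\\ i\equiv\ell\,(2)}}\big(g_1(2^k,m_1,2^{k-i})g_{-1}(2^\ell,m_2,2^{i+2})+(-\mu)g_{-1}(2^k,m_1,2^{k-i})g_1(2^\ell,m_2,2^{i+2})\big).$$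
   Context: $(\frac{\cdot}{\cdot})$ is the Kronecker symbol; for nonzero reals $(x,y)_{\mathbb R}=-1$ if $x,y<0$ and $1$ otherwise. For $\epsilon=\pm1$ and $n\ge3$ (also $n=2$ if $j$ is even), $g_\epsilon(2^j,m,2^n)=\sum_{x\in(\mathbb Z/2^n\mathbb Z)^\times,\ x\equiv\epsilon\,(\mathrm{mod}\,4)}(\frac{x}{2^j})e^{2\pi i mx/2^n}$. $\Gamma=\Gamma_1(4)$ is the group of $\gamma\in\mathrm{SL}(3,\mathbb Z)$ congruent mod $4$ to an upper triangular unipotent matrix, and $\Gamma_\infty$ is the group of upper triangular unipotent matrices in $\mathrm{SL}(3,\mathbb Z)$. The Plücker coordinates of a matrix with second row $(d,e,f)$ and third row $(g,h,i)$ are $(-g,-h,-i,-(dh-eg),di-fg,-(ei-fh))$; for $\gamma\in\Gamma$ they are written $(4A_1,4B_1,C_1,4A_2,4B_2,C_2)$ with integers $A_i,B_i,C_i$ (they satisfy $A_1C_2+4B_1B_2+C_1A_2=0$, $\gcd(A_i,B_i,C_i)=1$, $C_i\equiv-1$ mod $4$, and such tuples parametrize $\Gamma_\infty\backslash\Gamma$). Splitting: $s:\Gamma\to\{\pm1\}$ is the function such that $\gamma\mapsto(\gamma,s(\gamma))$ is Miller's splitting homomorphism of $\Gamma$ into the double cover of $\mathrm{SL}(3,\mathbb R)$; it is left and right $\Gamma_\infty$-invariant and for $A_1,A_2\neq0$ it is determined as follows. If $A_1>0$ and $A_2/D$ is odd, with $D=\gcd(A_1,A_2)$, $D_1=\gcd(D,B_1)$,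 $D_2=D/D_1$, $\epsilon=(\frac{-1}{B_1/D_1})$, then $$s(\gamma)=\Big(\tfrac{\epsilon}{-A_1A_2}\Big)\Big(\tfrac{A_1/D}{A_2/D}\Big)\Big(\tfrac{B_1/D_1}{A_1/D}\Big)\Big(\tfrac{4B_2/D_2}{|A_2|/D}\Big)\Big(\tfrac{D_1}{C_1}\Big)\Big(\tfrac{D_2}{C_2}\Big);$$ the remaining cases follow from $s(S_3\gamma S_3)=s(\gamma)$ with $S_3=\mathrm{diag}(1,1,-1)$, and $s(w_\ell{}^\intercal\gamma^{-1}w_\ell^{-1})=(-A_1,-A_2)_{\mathbb R}s(\gamma)$ with $w_\ell=\begin{pmatrix}0&0&1\\0&-1&0\\1&0&0\end{pmatrix}$. Exponential sums: for nonzero integers $A_1,A_2$, $\mathbb S(A_1,A_2)$ is the set of $\gamma\in\Gamma$ with Plücker coordinates $(4A_1,*,*,4A_2,*,* )$, and $\Sigma(A_1,A_2;m_1,m_2)=\sum_{\gamma\in\Gamma_\infty\backslash\mathbb S(A_1,A_2)/\Gamma_\infty}s(\gamma)e^{2\pi i(m_1\frac{B_1}{A_1}+m_2\frac{B_2}{A_2})}$ for $m_1,m_2\in\mathbb Z$ (an empty sum is $0$). *)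

(* Defs.v *)
From HB Require Import structures.
From mathcomp Require Import all_boot all_order all_algebra.
From mathcomp Require Import all_classical all_reals all_analysis.
From mathcomp Require Import complex.

Set Implicit Arguments.
Unset Strict Implicit.
Unset Printing Implicit Defensive.
Import Order.TTheory GRing.Theory Num.Theory.

Local Open Scope classical_set_scope.
Local Open Scope ring_scope.

(* The Kronecker symbol (a / n), with the standard conventions: (a / 0) is 1
   if a = 1 or a = -1 and 0 otherwise, (a / -1) is the sign of a with
   (0 / -1) = 1, and (a / 2) is 0 for even a, 1 for a = 1, 7 mod 8, and -1 for
   a = 3, 5 mod 8. *)
Definition legendre (a : int) (p : nat) : int :=
  if (p %| a)%Z then 0
  else if [exists x : 'I_p, (x%:Z ^+ 2 == a %[mod p])%Z] then 1 else -1.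

Definition kronecker_prime (a : int) (p : nat) : int :=
  if p == 2%N then
    if (2 %| a)%Z then 0
    else if (a == 1 %[mod 8])%Z || (a == 7 %[mod 8])%Z then 1 else -1
  else legendre a p.

Definition kronecker (a n : int) : int :=
  if n == 0 then (if (a == 1) || (a == -1) then 1 else 0)
  else (if (n < 0) && (a < 0) then -1 else 1) *
       \prod_(pe <- prime_decomp `|n|%N) kronecker_prime a pe.1 ^+ pe.2.

(* The Hilbert symbol (x, y)_R of the real numbers, for nonzero x and y. *)
Definition hilbert_real (x y : int) : int :=
  if (x < 0) && (y < 0) then -1 else 1.

Definition unipotent_upper : set 'M[int]_3 :=
  [set g | forall i j : 'I_3, (j <= i)%N -> g i j = (i == j)%:R].

(* Gamma_1(4) in SL(3, Z) *)
Definition Gamma : set 'M[int]_3 :=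
  [set g | \det g = 1 /\
           forall i j : 'I_3, (j <= i)%N -> (g i j = (i == j)%:R %[mod 4])%Z].

(* Rows are numbered 0, 1, 2: the second row (d, e, f) is row 1 and the third
   row (g, h, i) is row 2.  The Pluecker coordinates are
   (4 A1, 4 B1, C1, 4 A2, 4 B2, C2); on Gamma the divisions by 4 are exact. *)
Definition plA1 (g : 'M[int]_3) : int := ((- g 2 0)%R %/ 4)%Z.
Definition plB1 (g : 'M[int]_3) : int := ((- g 2 1)%R %/ 4)%Z.
Definition plC1 (g : 'M[int]_3) : int := - g 2 2.
Definition plA2 (g : 'M[int]_3) : int :=
  ((- (g 1 0 * g 2 1 - g 1 1 * g 2 0))%R %/ 4)%Z.
Definition plB2 (g : 'M[int]_3) : int :=
  ((g 1 0 * g 2 2 - g 1 2 * g 2 0)%R %/ 4)%Z.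
Definition plC2 (g : 'M[int]_3) : int :=
  - (g 1 1 * g 2 2 - g 1 2 * g 2 1).

(* The value of the splitting when A1 > 0 and A2 / D is odd.  All divisions
   below are exact on Gamma; for 4 B2 / D2 this follows from
   A1 C2 + 4 B1 B2 + C1 A2 = 0, although D2 need not divide B2. *)
Definition splitting_formula (g : 'M[int]_3) : int :=
  let A1 := plA1 g in let B1 := plB1 g in let C1 := plC1 g in
  let A2 := plA2 g in let B2 := plB2 g in let C2 := plC2 g in
  let D := gcdz A1 A2 in
  let D1 := gcdz D B1 in
  let D2 := (D %/ D1)%Z in
  let eps := kronecker (-1) (B1 %/ D1)%Z in
  kronecker eps (- (A1 * A2)) *
  kronecker (A1 %/ D)%Z (A2 %/ D)%Z *
  kronecker (B1 %/ D1)%Z (A1 %/ D)%Z *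
  kronecker ((4 * B2) %/ D2)%Z (`|A2| %/ D)%Z *
  kronecker D1 C1 *
  kronecker D2 C2.

Definition S3 : 'M[int]_3 := diag_mx (\row_j [:: 1; 1; -1]`_j).

Definition w_long : 'M[int]_3 :=
  \matrix_(i, j) (nth [::] [:: [:: 0;  0; 1];
                               [:: 0; -1; 0];
                               [:: 1;  0; 0]] i)`_j.

Definition conj_S3 (g : 'M[int]_3) : 'M[int]_3 := S3 *m g *m S3.

Definition inv_transpose_w (g : 'M[int]_3) : 'M[int]_3 :=
  w_long *m (invmx g)^T *m invmx w_long.

(* conj_S3 changes the signs of A1 and A2, and inv_transpose_w exchanges A1 and
   A2; if A2 / D is even then A1 / D is odd, so the relations
     s (conj_S3 g) = s g   and
     s (inv_transpose_w g) = hilbert_real (- A1) (- A2) * s g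
   reduce every g in Gamma with A1, A2 != 0 to splitting_formula.  The value
   is irrelevant when A1 * A2 = 0. *)
Definition splitting_odd (g : 'M[int]_3) : int :=
  if 0 < plA1 g then splitting_formula g else splitting_formula (conj_S3 g).

Definition splitting (g : 'M[int]_3) : int :=
  if ~~ (2 %| plA2 g %/ gcdz (plA1 g) (plA2 g))%Z then splitting_odd g
  else hilbert_real (- plA1 g) (- plA2 g) * splitting_odd (inv_transpose_w g).

Definition double_coset (g : 'M[int]_3) : set 'M[int]_3 :=
  [set u *m g *m v | u in unipotent_upper & v in unipotent_upper].

Definition SSet (A1 A2 : int) : set 'M[int]_3 :=
  [set g | [/\ Gamma g, plA1 g = A1 & plA2 g = A2]].

(* e(t) = exp (2 pi i t) *)
Definition cexp2pi (R : realType) (t : R) : R[i] :=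
  (cos (2 * pi * t) +i* sin (2 * pi * t))%C.

(* The finitely supported sum runs over the set of double cosets; the summand,
   which is constant on each double coset, is evaluated at a chosen element. *)
Definition Sigma (R : realType) (A1 A2 m1 m2 : int) : R[i] :=
  \sum_(X \in [set double_coset g | g in SSet A1 A2])
    let g := xget 0 X in
    (splitting g)%:~R *
    cexp2pi ((m1 * plB1 g)%:~R / A1%:~R + (m2 * plB2 g)%:~R / A2%:~R : R).

(* g_eps(c, m, q), for c = 2 ^ j and q = 2 ^ n: each class in (Z / q Z)^* is
   represented by its element in [0, q). *)
Definition gsum (R : realType) (eps : int) (c : nat) (m : int) (q : nat)
    : R[i] :=
  \sum_(0 <= x < q | coprime x q && (x%:Z == eps %[mod 4])%Z)
    (kronecker x c)%:~R * cexp2pi ((m * x%:Z)%:~R / q%:R : R).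

(* Main.v *)
Require Import Defs.
From HB Require Import structures.
From mathcomp Require Import all_boot all_order all_algebra.
From mathcomp Require Import all_classical all_reals all_analysis.
From mathcomp Require Import complex.
From mathcomp Require Import cyclic finfield ring lra zify.
Set Implicit Arguments.
Unset Strict Implicit.
Import Order.TTheory GRing.Theory Num.Theory.
Local Open Scope ring_scope.

(** Since [A2 / D] is [mu], only the first case of the definition of the
    splitting occurs.  The relation A1 C2 + 4 B1 B2 + C1 A2 = 0 forces [2 <= l],
    B1 = 2^i b and B2 = mu 2^(l-2-i) x with b, x odd, 0 <= i <= l - 2, and
    determines C1 = - mu 2^(k-l) C2 - b x.  Right multiplication by unipotent
    matrices changes b modulo 2^(k-i), x modulo 2^(i+2) and C2 modulo 2^(l+2), so
    the double cosets are indexed by (i, b, x, C2), subject to a congruence for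
    b x modulo 4 which expresses that C1 = -1 modulo 4.  The supplementary laws
    of quadratic reciprocity turn the splitting into a product of characters
    modulo 8 of b, x and C2.  Summing over C2 kills the terms in which i and l have
    different parity, and the sums over b and x are the sums g_eps. *)

(** * Kronecker symbols with a power of 2 *)

(** Complete multiplicativity on odd numbers rebuilds [f] from its values at primes; this is how a
    product over [prime_decomp], as in [kronecker], gets a closed form. *)
Lemma prod_prime_decomp_mult (f : nat -> int) (n : nat) :
  f 1%N = 1 ->
  (forall a b, odd a -> odd b -> f (a * b)%N = f a * f b) -> odd n ->
  \prod_(pe <- prime_decomp n) f pe.1 ^+ pe.2 = f n.
Proof.
move=> f1 fM n_odd; have n_gt0 : (0 < n)%N by case: n n_odd.
have fX a e : odd a -> f (a ^ e)%N = f a ^+ e.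
  move=> a_odd; elim: e => [|e IHe]; first by rewrite expn0 expr0.
  by rewrite expnS exprS fM ?IHe // oddX a_odd orbT.
rewrite [in RHS](prod_prime_decomp n_gt0).
have : all (fun pe => odd pe.1) (prime_decomp n).
  apply/allP=> -[p e] /mem_prime_decomp[_ e_gt0 pn] /=.
  by have := dvdn_odd pn n_odd; rewrite oddX; case: e e_gt0 {pn}.
elim: (prime_decomp n) => [|[p e] s IHs] /=; first by rewrite !big_nil.
case/andP=> p_odd s_odd; rewrite !big_cons IHs //= fM ?fX //.
  by rewrite oddX p_odd orbT.
elim: s s_odd {IHs} => [|[q e'] s IHs] /=; first by rewrite big_nil.
by case/andP=> q_odd s_odd; rewrite big_cons oddM IHs // oddX /= q_odd orbT.
Qed.

(** Shaped for Gauss's lemma, where the even factors of [h!] are met unchanged and the odd ones up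
    to sign. *)
Lemma fact_even_odd (h : nat) :
  (h`! = (\prod_(0 <= j < h./2) j.+1.*2) * \prod_(0 <= j < uphalf h) j.*2.+1)%N.
Proof.
elim: h => [|h IHh]; first by rewrite !big_geq.
have [m [hm|hm]] : exists m, h = m.*2 \/ h = m.*2.+1.
- by exists h./2; have := odd_double_half h; case: odd => <-;
  [right|left]; rewrite /= ?add0n ?add1n ?doubleK ?uphalf_double.
- rewrite factS IHh hm /= uphalf_double doubleK big_nat_recr //=.
  by rewrite [RHS]mulnA mulnC.
- rewrite factS IHh hm /= uphalf_double doubleK [in RHS]big_nat_recr //=.
  by rewrite mulnA [(m.*2.+2 * _)%N]mulnC.
Qed.

(** * Euler's criterion and the value of 2^((p-1)/2) modulo p *)

Section Euler.

Variables (p : nat) (p_pr : prime p) (p_odd : odd p).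

Let p_gt2 : (2 < p)%N.
Proof. by rewrite odd_prime_gt2. Qed.

Let half_p : p = (p./2).*2.+1.
Proof. by rewrite -[in LHS](odd_double_half p) p_odd. Qed.

Let p_char : p \in [pchar 'F_p].
Proof. exact: pchar_Fp. Qed.

Lemma Fp_intr_eq0 (a : int) : (a%:~R == 0 :> 'F_p) = (p %| a)%Z.
Proof.
rewrite dvdzE; case: a => n /=; last rewrite NegzE mulrNz oppr_eq0 /=;
  by rewrite -pmulrn -(dvdn_pcharf p_char).
Qed.

Lemma Fp_fermat (x : 'F_p) : x != 0 -> x ^+ p.-1 = 1.
Proof.
move=> x0; apply: (mulfI x0); rewrite -exprS prednK ?prime_gt0 // mulr1.
by have := expf_card x; rewrite card_Fp.
Qed.

Lemma Fp_prim_root : {z : 'F_p | (p.-1).-primitive_root z}.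
Proof.
have hp1 : (0 < p.-1)%N by rewrite -ltnS prednK ?prime_gt1 // prime_gt0.
(* The p - 1 nonzero elements are distinct (p - 1)-th roots of unity, and so many such roots in a
   field include a primitive one. *)
pose rs := [seq x <- enum 'F_p | x != 0].
have : has (p.-1).-primitive_root rs.
  apply: has_prim_root => //.
  - apply/allP=> x; rewrite mem_filter unity_rootE => /andP[x0 _].
    by rewrite Fp_fermat.
  - by rewrite filter_uniq // enum_uniq.
  - rewrite size_filter -(leq_add2r (count (pred1 (0 : 'F_p)) (enum 'F_p))).
    rewrite addnC -[X in (_ <= _ + X)%N]addn0.
    have -> : count [eta predC1 (0 : 'F_p)] (enum 'F_p) =
              count (predC (pred1 (0 : 'F_p))) (enum 'F_p) by [].
    rewrite addn0 [(count (predC _) _ + _)%N]addnC count_predC -cardE card_Fp //.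
    rewrite count_uniq_mem ?enum_uniq // mem_enum /= add1n.
    by rewrite prednK // prime_gt0.
by case/hasP/sig2W=> z _ hz; exists z.
Qed.

(* The nontrivial direction compares exponents of a primitive root. *)
Lemma legendre_euler (a : int) : ~~ (p %| a)%Z ->
  legendre a p = if (a%:~R : 'F_p) ^+ p./2 == 1 then 1 else -1.
Proof.
move=> pa; rewrite /legendre (negPf pa); congr (if _ then _ else _).
have h2 : p.-1 = (p./2 * 2)%N by rewrite [in LHS]half_p /= muln2.
have modP (b c : int) : (b == c %[mod p])%Z = (b%:~R == c%:~R :> 'F_p).
  by rewrite eqz_mod_dvd -Fp_intr_eq0 rmorphB /= subr_eq0.
have a0 : (a%:~R : 'F_p) != 0 by rewrite Fp_intr_eq0.
apply/existsP/eqP => [[x]|ha].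
  rewrite modP rmorphXn /= => /eqP xa; rewrite -xa -exprM mulnC -h2 Fp_fermat //.
  by apply: contraNneq a0 => x0; rewrite -xa x0 expr0n.
have [z hz] := Fp_prim_root.
have [[t ht] /= az] := prim_rootP hz (Fp_fermat a0).
have : (p.-1 %| t * p./2)%N by rewrite (prim_order_dvd hz) exprM -az ha.
rewrite h2 mulnC dvdn_pmul2r; last by case: (p) p_gt2 => [|[|[]]].
move=> /dvdnP[u tu].
have ltx (x : 'F_p) : (x < p)%N by rewrite -[X in (_ < X)%N](Fp_cast p_pr) ltn_ord.
exists (Ordinal (ltx (z ^+ u))); rewrite modP rmorphXn /=.
have -> : ((z ^+ u : nat)%:Z)%:~R = z ^+ u :> 'F_p.
  by rewrite -pmulrn; apply: natr_Zp.
by rewrite az tu exprM.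
Qed.

Lemma expr_signb_eq1 (n : nat) : ((-1 : 'F_p) ^+ n == 1) = ~~ odd n.
Proof.
have n1 : (-1 : 'F_p) != 1.
  rewrite eq_sym -subr_eq0 opprK -[1 + 1]/(2%:~R) Fp_intr_eq0 dvdzE /=.
  by apply/negP => /dvdn_leq-/(_ isT); rewrite leqNgt p_gt2.
by rewrite -signr_odd; case: (odd n); rewrite ?expr0 ?eqxx // expr1 (negPf n1).
Qed.

Lemma legendre_neg1 : legendre (-1) p = (-1) ^+ p./2.
Proof.
rewrite legendre_euler; last first.
  by rewrite dvdzE /= dvdn1; case: (p) p_gt2 => [|[|]].
by rewrite rmorphN1 expr_signb_eq1 -[RHS]signr_odd; case: odd.
Qed.

(* Gauss's lemma: of the even numbers 2, 4, ..., p - 1, those above p / 2 are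
   the negatives mod p of the odd numbers below p / 2. *)
Lemma Fp_expr2_half : (2%:R : 'F_p) ^+ p./2 = (-1) ^+ uphalf p./2.
Proof.
set h := p./2; set u := uphalf h.
have hu : h = (h./2 + u)%N by rewrite /u uphalf_half; have := odd_double_half h; lia.
have h0 : (h`!)%:R != 0 :> 'F_p.
  rewrite -(dvdn_pcharf p_char).
  have : (h < p)%N by rewrite [X in (_ < X)%N]half_p -addnn ltnS leq_addr.
  elim: (h) => [|m IHm] mp; first by rewrite fact0 dvdn1; case: (p) p_gt2 => [|[|]].
  rewrite factS Euclid_dvdM // negb_or IHm ?andbT; last exact: ltnW.
  by apply/negP => /dvdn_leq-/(_ isT); rewrite leqNgt mp.
apply: (mulIf h0).
have -> : 2%:R ^+ h * (h`!)%:R = \prod_(0 <= j < h) (j.+1.*2)%:R :> 'F_p.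
  elim: (h) => [|m IHm]; first by rewrite big_geq // mulr1.
  by rewrite big_nat_recr //= -IHm exprS factS -muln2 !natrM; ring.
have u_h : (h - h./2)%N = u by rewrite [X in (X - _)%N]hu addKn.
rewrite (@big_cat_nat _ _ _ h./2) ?leq_half //=; last by rewrite -divn2 leq_div.
rewrite fact_even_odd natrM !natr_prod.
rewrite mulrCA; congr (_ * _); rewrite -{1}[h./2]add0n big_addn u_h.
rewrite big_nat_rev /= -[in RHS](subn0 u) -prodr_const_nat -big_split /=.
apply: eq_big_nat => j /andP[_ ju].
rewrite -[LHS]subr0 -(pchar_Fp_0 p_pr) -[LHS]opprB mulN1r; congr (- _).
set t := (X in _ - X%:R).
have e : (t + j.*2.+1)%N = p by rewrite [RHS]half_p -/h /t; lia.
by rewrite -[X in X%:R - _]e natrD addrC addKr.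
Qed.

Lemma legendre_two_pow (i : nat) :
  legendre (2 ^+ i) p = (-1) ^+ (i * uphalf p./2).
Proof.
rewrite legendre_euler; last first.
  by rewrite -Fp_intr_eq0 rmorphXn /= expf_neq0 // -(dvdn_pcharf p_char) gtnNdvd.
rewrite rmorphXn /= -exprM mulnC exprM Fp_expr2_half -exprM mulnC expr_signb_eq1.
by rewrite -[RHS]signr_odd; case: odd.
Qed.

End Euler.

(** * The character [chi8] and the supplementary laws *)

Lemma divz_eq8 (a : int) :
  exists q, exists2 r, a = q * 8 + r & r \in [:: 0; 1; 2; 3; 4; 5; 6; 7 : int].
Proof.
exists (a %/ 8)%Z, (a %% 8)%Z; first exact: divz_eq.
have := ltz_pmod a (isT : 0 < 8%Z); have := modz_ge0 a (isT : 8%Z != 0).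
rewrite !inE; lia.
Qed.

(** The even quadratic character of conductor 8, extended by 0 to even integers. *)
Notation chi8 a := (kronecker_prime a 2).

Lemma chi8_mod (a : int) : chi8 a = chi8 (a %% 8)%Z.
Proof.
have e : (2 %| a)%Z = (2 %| (a %% 8)%Z)%Z.
  by rewrite {1}(divz_eq a 8) rpredDl ?dvdz_mull.
by rewrite /kronecker_prime /= !modz_mod e.
Qed.

Lemma chi8_modE (q r : int) : chi8 (q * 8 + r) = chi8 r.
Proof. by rewrite chi8_mod modzMDl -chi8_mod. Qed.

Lemma chi8M (a b : int) : chi8 (a * b) = chi8 a * chi8 b.
Proof.
have [q [r -> hr]] := divz_eq8 a; have [t [s -> hs]] := divz_eq8 b.
rewrite [X in chi8 X](_ : _ = (q * t * 8 + q * s + r * t) * 8 + r * s); last by ring.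
rewrite !chi8_modE; move: hr hs; rewrite !inE.
by do 7?[case/orP]; move=> /eqP-> ; do 7?[case/orP]; move=> /eqP->.
Qed.

(** Translates the exponent of Gauss's lemma: its parity depends only on [n] mod 8, which leaves
    four odd residues to check. *)
Lemma chi8_signz (n : nat) : odd n -> chi8 n%:Z = (-1) ^+ uphalf n./2.
Proof.
move=> n_odd; rewrite -[RHS]signr_odd chi8_mod modz_nat.
have := ltn_pmod n (isT : 0 < 8)%N; have := divn_eq n 8.
move: (n %/ 8)%N (n %% 8)%N => q r nq r8.
have -> : odd (uphalf n./2) = odd (uphalf r./2).
  have -> : n./2 = (q * 4 + r./2)%N by lia.
  rewrite !uphalf_half; lia.
have : odd r by lia.
by case: r r8 {nq} => [|[|[|[|[|[|[|[|r]]]]]]]].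
Qed.

Lemma chi8N (a : int) : chi8 (- a) = chi8 a.
Proof. by rewrite -mulN1r chi8M mul1r. Qed.

(** A candidate [f] that agrees with the Legendre symbol at odd primes is extended by
    multiplicativity; the unit of a negative [n] contributes the remaining sign. *)
Lemma kronecker_odd_prod (f : nat -> int) (a n : int) :
  (forall p, prime p -> odd p -> legendre a p = f p) -> f 1%N = 1 ->
  (forall b c, odd b -> odd c -> f (b * c)%N = f b * f c) ->
  odd `|n| ->
  kronecker a n = (if (n < 0) && (a < 0) then -1 else 1) * f `|n|%N.
Proof.
move=> fp f1 fM n_odd; rewrite /kronecker; case: eqP => [n0|_].
  by rewrite n0 in n_odd.
rewrite -(prod_prime_decomp_mult f1 fM n_odd); congr (_ * _).
apply: eq_big_seq => -[p e] /mem_prime_decomp[p_pr e_gt0 pn] /=.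
have p_odd : odd p by have := dvdn_odd pn n_odd; rewrite oddX; case: e e_gt0 {pn}.
by rewrite /kronecker_prime; case: eqP => [p2|_]; [rewrite p2 in p_odd|rewrite fp].
Qed.

(** First supplementary law. For negative [b] the sign attached to the unit -1 turns the condition
    on the absolute value into one on [b] itself. *)
Lemma kronecker_neg1 (b : int) : odd `|b| ->
  kronecker (-1) b = if (b == 1 %[mod 4])%Z then 1 else -1.
Proof.
move=> b_odd; rewrite (@kronecker_odd_prod (fun n => (-1) ^+ n./2)) //=; first last.
- move=> c d c_odd d_odd; rewrite -exprD -signr_odd -[RHS]signr_odd; congr (_ ^+ nat_of_bool _).
  have oddE (m : nat) : odd m -> exists s, m = s.*2.+1.
    by move=> m_odd; exists m./2; have := odd_double_half m; rewrite m_odd.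
  have [s ->] := oddE _ c_odd; have [t ->] := oddE _ d_odd.
  rewrite (_ : (s.*2.+1 * t.*2.+1)%N = (2 * (s * t) + s + t).*2.+1); last by lia.
  by rewrite /= !uphalf_double !oddD oddM; case: (odd s); case: (odd t).
- by move=> p p_pr p_odd; rewrite legendre_neg1.
rewrite andbT -signr_odd; case o: (odd _); case: ltP => b0; case: eqP => h //; exfalso; lia.
Qed.

(** Second supplementary law. The numerator is positive and [chi8] is even, so the sign of [c] has
    no effect. *)
Lemma kronecker_two_pow (i : nat) (c : int) : odd `|c| ->
  kronecker (2 ^+ i) c = chi8 c ^+ i.
Proof.
move=> c_odd; rewrite (@kronecker_odd_prod (fun n => chi8 n%:Z ^+ i)) //=; first last.
- by move=> a b _ _; rewrite PoszM chi8M exprMn.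
- by rewrite expr1n.
- by move=> p p_pr p_odd; rewrite legendre_two_pow // chi8_signz // -exprM mulnC.
rewrite [2 ^+ i < 0]ltNge exprn_ge0 // andbF mul1r.
by case: (ger0P c) => // _; rewrite ?abszE; case: c c_odd => n //= _; rewrite NegzE chi8N.
Qed.

Lemma kronecker_pow2 (a e : int) (n : nat) : (e = 1) \/ (e = -1) ->
  kronecker a (e * 2 ^+ n) = (if (e < 0) && (a < 0) then -1 else 1) * chi8 a ^+ n.
Proof.
move=> he; have e0 : e * 2 ^+ n != 0 by rewrite mulf_neq0 ?expf_neq0 //; case: he => ->.
rewrite /kronecker (negPf e0) pmulr_llt0 ?exprn_gt0 //; congr (_ * _).
have -> : absz (e * 2 ^+ n) = (2 ^ n)%N by rewrite abszM abszX; case: he => ->; rewrite mul1n.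
case: n {e0} => [|n]; first by rewrite big_nil.
by rewrite prime_decompE primesX // big_seq1 pfactorK.
Qed.

(** * Double cosets and Pluecker coordinates *)

Lemma ord3_ind (P : 'I_3 -> Prop) : P 0 -> P 1 -> P 2 -> forall i, P i.
Proof.
by move=> P0 P1 P2 [[|[|[|//]]] i3]; [move: P0|move: P1|move: P2]; congr P; apply: val_inj.
Qed.

Lemma sum_ord3 (R : nmodType) (F : 'I_3 -> R) : \sum_i F i = F 0 + F 1 + F 2.
Proof.
rewrite !big_ord_recl big_ord0 addr0 addrA.
by congr (_ + F _ + F _); apply: val_inj.
Qed.

Lemma det3 (R : comNzRingType) (A : 'M[R]_3) : \det A =
  A 0 0 * (A 1 1 * A 2 2 - A 1 2 * A 2 1) +
  A 0 1 * (A 1 2 * A 2 0 - A 1 0 * A 2 2) +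
  A 0 2 * (A 1 0 * A 2 1 - A 1 1 * A 2 0).
Proof.
pose a m n := A (inord m) (inord n); have aE i j : A i j = a i j.
  by rewrite /a !inord_val.
rewrite (expand_det_row _ 0) sum_ord3 /cofactor.
rewrite !(expand_det_row _ 0) !big_ord_recl !big_ord0 /cofactor !det_mx11 !mxE.
by rewrite !aE /= /bump /=; ring.
Qed.

Definition mx3 (s : seq (seq int)) : 'M[int]_3 := \matrix_(i, j) (nth [::] s i)`_j.

(** The adjugate, whose columns are cross products of the rows of [g]; written out so that [ring]
    can compute with it. *)
Definition adj3 (g : 'M[int]_3) : 'M[int]_3 := mx3
  [:: [:: g 1 1 * g 2 2 - g 1 2 * g 2 1; g 2 1 * g 0 2 - g 2 2 * g 0 1;
          g 0 1 * g 1 2 - g 0 2 * g 1 1];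
      [:: g 1 2 * g 2 0 - g 1 0 * g 2 2; g 2 2 * g 0 0 - g 2 0 * g 0 2;
          g 0 2 * g 1 0 - g 0 0 * g 1 2];
      [:: g 1 0 * g 2 1 - g 1 1 * g 2 0; g 2 0 * g 0 1 - g 2 1 * g 0 0;
          g 0 0 * g 1 1 - g 0 1 * g 1 0]].

Lemma mul_adj3_mx (g : 'M[int]_3) : adj3 g *m g = (\det g)%:M.
Proof.
apply/matrixP; elim/ord3_ind; elim/ord3_ind; rewrite !mxE sum_ord3 !mxE /= det3.
all: rewrite ?mulr1n ?mulr0n; ring.
Qed.

(** The quotient of [h] by [g] is [h *m adj3 g], whose entries on and below the diagonal are triple
    products of rows. These depend only on row 2, the minors of rows 1 and 2 and the determinants,
    which agree for [g] and [h]. *)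
Lemma plucker_row_eq (g h : 'M[int]_3) : \det g = 1 -> \det h = 1 ->
  (forall j, h 2 j = g 2 j) ->
  h 1 1 * g 2 2 - h 1 2 * g 2 1 = g 1 1 * g 2 2 - g 1 2 * g 2 1 ->
  h 1 0 * g 2 2 - h 1 2 * g 2 0 = g 1 0 * g 2 2 - g 1 2 * g 2 0 ->
  h 1 0 * g 2 1 - h 1 1 * g 2 0 = g 1 0 * g 2 1 - g 1 1 * g 2 0 ->
  exists2 u, unipotent_upper u & h = u *m g.
Proof.
move=> detg deth h2 m12 m02 m01; exists (h *m adj3 g); last first.
  by rewrite -mulmxA mul_adj3_mx detg mulmx1.
move: detg deth; rewrite !det3 !h2 => detg deth.
have m20 : h 1 2 * g 2 0 - h 1 0 * g 2 2 = g 1 2 * g 2 0 - g 1 0 * g 2 2.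
  by rewrite -[LHS]opprB m02 opprB.
elim/ord3_ind; elim/ord3_ind => // _; rewrite !mxE sum_ord3 !mxE /= ?h2.
- by rewrite -m12 -m01 -m20.
- by rewrite -m12 -m01 -m20; ring.
- rewrite -[RHS]detg -m12 -m01 -m20; ring.
- ring.
- ring.
- by rewrite -[RHS]detg; ring.
Qed.

Definition umx (p q r : int) : 'M[int]_3 :=
  mx3 [:: [:: 1; p; q]; [:: 0; 1; r]; [:: 0; 0; 1]].

Lemma umx_unipotent p q r : unipotent_upper (umx p q r).
Proof. by elim/ord3_ind; elim/ord3_ind => // _; rewrite mxE. Qed.

Lemma unipotentE u : unipotent_upper u -> u = umx (u 0 1) (u 0 2) (u 1 2).
Proof.
move=> hu; apply/matrixP; elim/ord3_ind; elim/ord3_ind; rewrite !mxE //=; exact: hu.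
Qed.

Lemma umxM p q r p' q' r' :
  umx p q r *m umx p' q' r' = umx (p + p') (q + q' + p * r') (r + r').
Proof.
apply/matrixP; elim/ord3_ind; elim/ord3_ind; rewrite !mxE sum_ord3 !mxE /=; ring.
Qed.

Lemma umx0 : umx 0 0 0 = 1%:M.
Proof. by apply/matrixP; elim/ord3_ind; elim/ord3_ind; rewrite !mxE. Qed.

Lemma double_cosetP (g h : 'M[int]_3) : double_coset g h <->
  exists a b c p q r, h = umx a b c *m g *m umx p q r.
Proof.
split=> [[u /unipotentE-> [v /unipotentE-> <-]]|[a [b [c [p [q [r ->]]]]]]].
  by do 6!eexists.
by exists (umx a b c); [exact: umx_unipotent|exists (umx p q r) => //; exact: umx_unipotent].
Qed.

Lemma double_coset_refl (g : 'M[int]_3) : double_coset g g.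
Proof.
by apply/double_cosetP; exists 0, 0, 0, 0, 0, 0; rewrite umx0 mulmx1 mul1mx.
Qed.

Lemma double_coset_sub (g h : 'M[int]_3) :
  double_coset g h -> (double_coset h `<=` double_coset g)%classic.
Proof.
move=> /double_cosetP[a [b [c [p [q [r ->]]]]]] x.
move=> /double_cosetP[a' [b' [c' [p' [q' [r' ->]]]]]]; apply/double_cosetP.
exists (a' + a), (b' + b + a' * c), (c' + c), (p + p'), (q + q' + p * r'), (r + r').
by rewrite -!umxM !mulmxA.
Qed.

Lemma double_coset_sym (g h : 'M[int]_3) : double_coset g h -> double_coset h g.
Proof.
move=> /double_cosetP[a [b [c [p [q [r ->]]]]]]; apply/double_cosetP.
exists (- a), (a * c - b), (- c), (- p), (p * r - q), (- r).
rewrite !mulmxA umxM -mulmxA umxM -[LHS]mul1mx -[LHS]mulmx1 -umx0.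
by congr (umx _ _ _ *m _ *m umx _ _ _); ring.
Qed.

Lemma double_coset_eq (g h : 'M[int]_3) :
  double_coset g h -> double_coset g = double_coset h.
Proof.
move=> gh; apply/seteqP; split; last exact: double_coset_sub.
exact: double_coset_sub (double_coset_sym gh).
Qed.

(** Division-free form of the Pluecker coordinates, as polynomial equations open to [ring].
    Membership in [Gamma] is a separate condition. *)
Definition has_coords (g : 'M[int]_3) (A1 B1 C1 A2 B2 C2 : int) : Prop :=
  [/\ g 2 0 = - (4 * A1), g 2 1 = - (4 * B1) & g 2 2 = - C1] /\
  [/\ g 1 0 * g 2 1 - g 1 1 * g 2 0 = - (4 * A2),
      g 1 0 * g 2 2 - g 1 2 * g 2 0 = 4 * B2
    & g 1 1 * g 2 2 - g 1 2 * g 2 1 = - C2].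

Lemma has_coords_pl (g : 'M[int]_3) A1 B1 C1 A2 B2 C2 :
  has_coords g A1 B1 C1 A2 B2 C2 ->
  [/\ plA1 g = A1, plB1 g = B1 & plC1 g = C1] /\
  [/\ plA2 g = A2, plB2 g = B2 & plC2 g = C2].
Proof.
move=> [[g20 g21 g22] [m01 m02 m12]].
rewrite /plA1 /plB1 /plC1 /plA2 /plB2 /plC2 m01 m02 m12 g20 g21 g22 !opprK.
by split; split=> //; rewrite mulrC mulzK.
Qed.

Lemma has_coords_rel (g : 'M[int]_3) A1 B1 C1 A2 B2 C2 :
  has_coords g A1 B1 C1 A2 B2 C2 -> A1 * C2 + 4 * B1 * B2 + C1 * A2 = 0.
Proof.
move=> [[g20 g21 g22] [m01 m02 m12]].
(* Expansion of a determinant in which row 2 occurs twice. *)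
have : g 2 0 * (g 1 1 * g 2 2 - g 1 2 * g 2 1) -
       g 2 1 * (g 1 0 * g 2 2 - g 1 2 * g 2 0) +
       g 2 2 * (g 1 0 * g 2 1 - g 1 1 * g 2 0) = 0 by ring.
rewrite m01 m02 m12 g20 g21 g22 => e.
have : 4 * (A1 * C2 + 4 * B1 * B2 + C1 * A2) = 0 by rewrite -[RHS]e; ring.
lia.
Qed.

(** The left factor fixes row 2 and the minors of rows 1 and 2; the right factor acts linearly on
    both, which gives the shifts by [p], [q] and [r]. *)
Lemma has_coords_umx (g : 'M[int]_3) A1 B1 C1 A2 B2 C2 a b c p q r :
  has_coords g A1 B1 C1 A2 B2 C2 ->
  has_coords (umx a b c *m g *m umx p q r)
    A1 (B1 + p * A1) (C1 + 4 * (r * B1) + 4 * (q * A1))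
    A2 (B2 - r * A2) (C2 - 4 * (q * A2) - 4 * (p * B2) + 4 * (p * r * A2)).
Proof.
move=> [[g20 g21 g22] [m01 m02 m12]].
split; split; rewrite !(mxE, sum_ord3) /=.
- by rewrite g20; ring.
- by rewrite g20 g21; ring.
- by rewrite g20 g21 g22; ring.
- by rewrite -m01; ring.
- rewrite [RHS](_ : _ = 4 * B2 + r * - (4 * A2)); last by ring.
  by rewrite -m01 -m02; ring.
- rewrite [RHS](_ : _ = - C2 - q * - (4 * A2) + p * (4 * B2) + p * r * - (4 * A2));
    last by ring.
  by rewrite -m01 -m02 -m12; ring.
Qed.

Lemma Gamma_has_coords (g : 'M[int]_3) : Gamma g ->
  [/\ has_coords g (plA1 g) (plB1 g) (plC1 g) (plA2 g) (plB2 g) (plC2 g),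
      (plC1 g = 3 %[mod 4])%Z & (plC2 g = 3 %[mod 4])%Z].
Proof.
move=> [_ hg].
have g20 : (g 2%R 0%R = 0 %[mod 4])%Z by exact: (hg 2 0).
have g21 : (g 2%R 1%R = 0 %[mod 4])%Z by exact: (hg 2 1).
have g10 : (g 1%R 0%R = 0 %[mod 4])%Z by exact: (hg 1 0).
have g11 : (g 1%R 1%R = 1 %[mod 4])%Z by exact: (hg 1 1).
have g22 : (g 2%R 2%R = 1 %[mod 4])%Z by exact: (hg 2 2).
have divE (x : int) : (x = 0 %[mod 4])%Z -> exists y, x = y * 4.
  by move=> hx; exists (x %/ 4)%Z; lia.
have div1E (x : int) : (x = 1 %[mod 4])%Z -> exists y, x = y * 4 + 1.
  by move=> hx; exists (x %/ 4)%Z; lia.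
have [x20 e20] := divE _ g20; have [x21 e21] := divE _ g21.
have [x10 e10] := divE _ g10; have [x11 e11] := div1E _ g11.
have [x22 e22] := div1E _ g22.
rewrite /has_coords /plA1 /plB1 /plC1 /plA2 /plB2 /plC2 e20 e21 e10 e11 e22.
have div4 (y x : int) : x = y * 4 -> (x %/ 4)%Z = y by move=> ->; rewrite mulzK.
split; first split; first split; rewrite ?opprK //.
- by rewrite (div4 (- x20)); ring.
- by rewrite (div4 (- x21)); ring.
- split; rewrite ?opprK //.
    by rewrite (div4 (- (x10 * x21 * 4 - (x11 * 4 + 1) * x20))); ring.
  by rewrite (div4 (x10 * (x22 * 4 + 1) - g 1 2 * x20)); ring.
- by rewrite (_ : - (x22 * 4 + 1) = (- x22 - 1) * 4 + 3) ?modzMDl //; ring.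
- rewrite [X in (X %% _)%Z](_ : _ =
    (- (x11 * x22 * 4 + x11 + x22) + g 1 2 * x21 - 1) * 4 + 3) ?modzMDl //; ring.
Qed.

Lemma Gamma_exists (A1 B1 C1 A2 B2 C2 : int) :
  A1 * C2 + 4 * B1 * B2 + C1 * A2 = 0 ->
  (C1 = 3 %[mod 4])%Z -> (C2 = 3 %[mod 4])%Z ->
  coprimez C1 (4 * A1) -> coprimez C2 (4 * A2) ->
  exists2 g, Gamma g & has_coords g A1 B1 C1 A2 B2 C2.
Proof.
move=> rel hC1 hC2 /coprimezP[[y2 y0] /= hy] /coprimezP[[a c] /= ha].
(* Row 1 is y x N, where y . (row 2) = 1 and N is the prescribed cross product of
   rows 1 and 2; row 0 completes the determinant to row0 . N = 1. *)
pose g := mx3 [:: [:: - a; 0; - c];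
                  [:: - (4 * y2 * B2); y2 * C2 - 4 * y0 * A2; 4 * y0 * B2];
                  [:: - (4 * A1); - (4 * B1); - C1]].
have gco : has_coords g A1 B1 C1 A2 B2 C2.
  split; split; rewrite !mxE //=.
  - transitivity (4 * y2 * (A1 * C2 + 4 * B1 * B2 + C1 * A2) -
        4 * A2 * (y2 * C1 + y0 * (4 * A1))); first by ring.
    by rewrite rel hy; ring.
  - transitivity (4 * B2 * (y2 * C1 + y0 * (4 * A1))); first by ring.
    by rewrite hy mulr1.
  - transitivity (4 * y0 * (A1 * C2 + 4 * B1 * B2 + C1 * A2) -
        C2 * (y2 * C1 + y0 * (4 * A1))); first by ring.
    by rewrite rel hy; ring.
exists g => //; split.
  have [_ [m01 m02 m12]] := gco.
  by rewrite det3 m12 m01 !mxE /= -[RHS]ha; ring.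
have mod3 (x : int) : (x = 3 %[mod 4])%Z -> exists k, x = 4 * k + 3.
  by move=> hx; exists (x %/ 4)%Z; lia.
have [k1 e1] := mod3 _ hC1; have [k2 e2] := mod3 _ hC2.
(* Modulo 4 the two Bezout relations read 3 * y2 = 1 and 3 * a = 1, so the diagonal entries of [g]
   are congruent to 1. *)
have y2_mod : (y2 = 3 %[mod 4])%Z.
  have e : 4 * (y2 * k1 + y0 * A1) + 3 * y2 = 1 by rewrite -[RHS]hy e1; ring.
  lia.
have a_mod : (a = 3 %[mod 4])%Z.
  have e : 4 * (a * k2 + c * A2) + 3 * a = 1 by rewrite -[RHS]ha e2; ring.
  lia.
have [z ez] := mod3 _ y2_mod.
elim/ord3_ind; elim/ord3_ind => // _; rewrite mxE /=.
- lia.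
- by rewrite (_ : - _ = - (y2 * B2) * 4 + 0) ?modzMDl //; ring.
- rewrite (_ : _ - _ = (4 * z * k2 + 3 * z + 3 * k2 + 2 - y0 * A2) * 4 + 1) ?modzMDl //.
  by rewrite e2 ez; ring.
- by rewrite (_ : - _ = - A1 * 4 + 0) ?modzMDl //; ring.
- by rewrite (_ : - _ = - B1 * 4 + 0) ?modzMDl //; ring.
- by rewrite (_ : - _ = (- k1 - 1) * 4 + 1) ?modzMDl // e1; ring.
Qed.

(** * The splitting on the cosets with A1 = 2 ^ k and A2 = mu * 2 ^ l *)

Lemma Posz_pow2 (n : nat) : Posz (2 ^ n)%N = 2 ^+ n.
Proof. by elim: n => // n IHn; rewrite expnS exprS PoszM IHn. Qed.

Lemma int_pow2_decomp (x : int) : x != 0 -> exists i b, x = 2 ^+ i * b /\ odd `|b|.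
Proof.
move=> x0; have ax : (0 < `|x|)%N by rewrite absz_gt0.
have [b hb e] := pfactor_coprime (isT : prime 2) ax.
exists (logn 2 `|x|), ((-1) ^+ (x < 0)%R * b%:Z); rewrite abszMsign -coprime2n.
split=> //; rewrite mulrCA [LHS](intEsign x).
by rewrite [in LHS]e mulnC PoszM Posz_pow2.
Qed.

Lemma pow2_odd_inj (i j : nat) (b c : int) : odd `|b| -> odd `|c| ->
  2 ^+ i * b = 2 ^+ j * c -> i = j /\ b = c.
Proof.
move=> b_odd c_odd e.
have ij : i = j.
  have := congr1 (logn 2 \o absz) e.
  rewrite /= !abszM !abszX (_ : absz 2 = 2%N) // !lognM
    ?(odd_gt0 b_odd) ?(odd_gt0 c_odd) ?expn_gt0 //.
  rewrite !pfactorK //.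
  have logn_odd (z : nat) : odd z -> logn 2 z = 0%N.
    by move=> z_odd; rewrite lognE dvdn2 z_odd /= andbF.
  by rewrite !logn_odd // !addn0.
by split=> //; move: e; rewrite ij; apply: mulfI; rewrite expf_neq0.
Qed.

Lemma expr_subnK (R : pzSemiRingType) (x : R) (m n : nat) :
  (n <= m)%N -> x ^+ m = x ^+ n * x ^+ (m - n).
Proof. by move=> nm; rewrite -exprD subnKC. Qed.

Lemma gcdz_pow2 (k l : nat) (mu : int) : (l <= k)%N -> mu = 1 \/ mu = -1 ->
  gcdz (2 ^+ k) (mu * 2 ^+ l) = 2 ^+ l.
Proof.
move=> lk hmu; rewrite /gcdz abszM !abszX (_ : absz mu = 1%N); last by case: hmu => ->.
by rewrite mul1n -(subnK lk) expnD gcdnC gcdnMl Posz_pow2.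
Qed.

Lemma gcdz_pow2_odd (l i : nat) (b : int) : (i <= l)%N -> odd `|b| ->
  gcdz (2 ^+ l) (2 ^+ i * b) = 2 ^+ i.
Proof.
move=> il b_odd; rewrite /gcdz abszM !abszX -(subnKC il) expnD -muln_gcdr.
rewrite (_ : gcdn _ _ = 1%N) ?muln1 ?Posz_pow2 //.
by apply/eqP; rewrite -/(coprime _ _) coprimeXl // coprime2n.
Qed.

(** The relation reads 4 B1 B2 = - 2^l (2^(k-l) C2 + mu C1). Since k > l and C1 is odd, the bracket
    is odd, so the valuations of B1 and B2 at 2 add up to l - 2. The bound [i < l.-1] also encodes 2
    <= l. *)
Lemma SSet_coords (k l : nat) (mu : int) (g : 'M[int]_3) :
  (l < k)%N -> mu = 1 \/ mu = -1 -> SSet (2 ^+ k) (mu * 2 ^+ l) g ->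
  exists i b x c, [/\ (i < l.-1)%N, odd `|b|, odd `|x|,
    ((- mu * 2 ^+ (k - l) * (4 * c + 3) - b * x)%R = 3 %[mod 4])%Z &
    has_coords g (2 ^+ k) (2 ^+ i * b) (- mu * 2 ^+ (k - l) * (4 * c + 3) - b * x)
      (mu * 2 ^+ l) (mu * 2 ^+ (l - 2 - i) * x) (4 * c + 3)].
Proof.
move=> lk hmu [/Gamma_has_coords[]]; set B1 := plB1 g; set B2 := plB2 g.
set C1 := plC1 g; set C2 := plC2 g => hg hC1 hC2 hA1 hA2.
rewrite hA1 hA2 in hg.
have [c ec] : exists c, C2 = 4 * c + 3 by exists (C2 %/ 4)%Z; lia.
have [c1 ec1] : exists c, C1 = 4 * c + 3 by exists (C1 %/ 4)%Z; lia.
have rel := has_coords_rel hg.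
have musq : mu * mu = 1 by case: hmu => ->.
have [w ew] : exists w, 2 ^+ (k - l) = 2 * w :> int.
  by exists (2 ^+ (k - l).-1); rewrite -exprS prednK // subn_gt0.
have ekl : 2 ^+ k = 2 ^+ l * 2 ^+ (k - l) :> int by rewrite -expr_subnK // ltnW.
have odd_w : odd `|mu * 2 ^+ (k - l) * C2 + C1| by rewrite ew; lia.
have relw : 4 * (B1 * B2) = 2 ^+ l * (- mu * (mu * 2 ^+ (k - l) * C2 + C1)).
  rewrite [RHS](_ : _ = - (mu * mu) * (2 ^+ l * 2 ^+ (k - l) * C2) - C1 * (mu * 2 ^+ l));
    last by ring.
  by rewrite musq -ekl; lia.
have odd_w' : odd `|- mu * (mu * 2 ^+ (k - l) * C2 + C1)|.
  by rewrite abszM oddM odd_w andbT; case: hmu => ->.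
have BB0 : B1 * B2 != 0.
  apply/negP => /eqP e0; move: relw; rewrite e0 mulr0 => /esym/eqP.
  by rewrite mulf_eq0 expf_eq0 /= andbF => /eqP e; rewrite e in odd_w'.
move: BB0; rewrite mulf_eq0 negb_or => /andP[/int_pow2_decomp[i [b [eB1 b_odd]]]].
move=> /int_pow2_decomp[j [y [eB2 y_odd]]].
have by_odd : odd `|b * y| by rewrite abszM oddM b_odd.
have [|ijl by_w] := @pow2_odd_inj (i + j).+2 l _ _ by_odd odd_w'.
  by rewrite -relw eB1 eB2 !exprS exprD; ring.
(* The witness for [x] is [mu * y], because B2 = 2^j y is to take the form mu 2^(l-2-i) x and mu^2 =
   1. *)
exists i, b, (mu * y), c.
have eC1 : - mu * 2 ^+ (k - l) * (4 * c + 3) - b * (mu * y) = C1.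
  rewrite mulrCA by_w -ec.
  rewrite [LHS](_ : _ = - mu * 2 ^+ (k - l) * C2 + (mu * mu) * (mu * 2 ^+ (k - l) * C2 + C1));
    last by ring.
  by rewrite musq; ring.
rewrite eC1 -ec -eB1; split=> //.
- by rewrite -ijl /= ltnS leq_addr.
- by rewrite abszM oddM y_odd andbT; case: hmu => ->.
- rewrite (_ : mu * 2 ^+ _ * (mu * y) = B2) //.
  rewrite [LHS](_ : _ = (mu * mu) * (2 ^+ (l - 2 - i) * y)); last by ring.
  by rewrite musq mul1r -ijl subn2 /= addKn.
Qed.

(** The factors of the splitting for D = 2^l, D1 = 2^i and D2 = 2^(l-i), in order: (eps / -A1 A2),
    ((B1/D1) / (A1/D)), (D1 / C1) and (D2 / C2), with [d] for k - l and [n] for l - i. *)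
Definition split_value (mu b C1 C2 : int) (d i n : nat) : int :=
  (if (b == 1 %[mod 4])%Z then 1 else - mu) * chi8 b ^+ d * chi8 C1 ^+ i * chi8 C2 ^+ n.

Lemma splitting_eval (k l i : nat) (mu b C1 B2 C2 : int) (g : 'M[int]_3) :
  (l < k)%N -> (i <= l)%N -> mu = 1 \/ mu = -1 ->
  odd `|b| -> odd `|C1| -> odd `|C2| ->
  has_coords g (2 ^+ k) (2 ^+ i * b) C1 (mu * 2 ^+ l) B2 C2 ->
  splitting g = split_value mu b C1 C2 (k - l) i (l - i).
Proof.
move=> lk il hmu b_odd C1_odd C2_odd /has_coords_pl[[hA1 hB1 hC1] [hA2 hB2 hC2]].
have pow0 n : 2 ^+ n != 0 :> int by rewrite expf_neq0.
have div_pow2 m n : (n <= m)%N -> (2 ^+ m %/ 2 ^+ n)%Z = 2 ^+ (m - n).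
  by move=> nm; rewrite (expr_subnK 2 nm) mulKz.
have hD := gcdz_pow2 (ltnW lk) hmu.
rewrite /splitting /splitting_odd hA1 hA2 hD mulzK // ifT; last by case: hmu => ->.
rewrite exprn_gt0 // /splitting_formula hA1 hA2 hB1 hC1 hC2 hD gcdz_pow2_odd //.
rewrite (div_pow2 _ _ (ltnW lk)) (div_pow2 _ _ il) mulKz // mulzK //.
(* As |A2|/D = 1, the symbol containing B2 is trivial. *)
have -> : (absz (mu * 2 ^+ l) %/ 2 ^+ l)%Z = 1.
  rewrite abszM abszX (_ : absz mu = 1%N); last by case: hmu => ->.
  by rewrite mul1n Posz_pow2 divzz pow0.
have k1 (a : int) : kronecker a 1 = 1 by rewrite /kronecker /= big_nil.
have kb : kronecker b (2 ^+ (k - l)) = chi8 b ^+ (k - l).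
  by rewrite -[2 ^+ _]mul1r kronecker_pow2 ?mul1r //; left.
have mu_odd : odd `|mu| by case: hmu => ->.
rewrite k1 kb !kronecker_two_pow // (_ : chi8 mu = 1); last by case: hmu => ->.
rewrite expr1n !mulr1 /split_value; congr (_ * _ * _ * _).
(* eps is 1 or -1 according to [b] mod 4. For eps = -1 only the sign of -A1 A2 counts, as
   [chi8 (-1)] is 1, and it contributes -mu. *)
rewrite kronecker_neg1 // (_ : - (2 ^+ k * (mu * 2 ^+ l)) = - mu * 2 ^+ (k + l)); last first.
  by rewrite exprD; ring.
rewrite kronecker_pow2; last by case: hmu => ->; [right|left].
case: (b == 1 %[mod 4])%Z.
  by rewrite (_ : chi8 1 = 1) // expr1n mulr1; case: hmu => ->.
by rewrite (_ : chi8 (-1) = 1) // expr1n mulr1; case: hmu => ->.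
Qed.

(* The ratio chi8 C1 / chi8 (b x) for C1 = - mu 2^d C2 - b x; see [chi8_C1]. *)
Definition kappa (mu : int) (d : nat) : int :=
  if d == 1%N then - mu else if d == 2%N then -1 else 1.

(** As [chi8] is even, C1 is compared with - b x. Modulo 8 the term mu 2^d C2 vanishes for d >= 3
    and is 4 for d = 2, which flips [chi8]. For d = 1 the congruence forces b x = 3 mod 4, and the
    shift by -6 mu then flips [chi8] exactly when mu = 1. *)
Lemma chi8_C1 (mu b x c : int) (d : nat) : (0 < d)%N -> mu = 1 \/ mu = -1 ->
  odd `|b| -> odd `|x| ->
  ((- mu * 2 ^+ d * (4 * c + 3) - b * x)%R = 3 %[mod 4])%Z ->
  chi8 (- mu * 2 ^+ d * (4 * c + 3) - b * x) = kappa mu d * chi8 b * chi8 x.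
Proof.
move=> d0 hmu b_odd x_odd hmod; rewrite -[RHS]mulrA -chi8M; move: hmod.
have : odd `|b * x| by rewrite abszM oddM b_odd.
move: (b * x) => {b x b_odd x_odd} y y_odd.
have [q [r ey hr]] := divz_eq8 y.
have [e he] : exists e, c = 2 * e \/ c = 2 * e + 1 by exists (c %/ 2)%Z; lia.
case: d d0 => [//|[|[|d]]] _; rewrite /kappa /=.
- rewrite expr1; case: hmu => ->; rewrite ey chi8_modE => h.
  + rewrite (_ : - 1 * 2 * (4 * c + 3) - (q * 8 + r) = (- c - q) * 8 + (- 6 - r)); last by ring.
    rewrite chi8_modE; move: hr h; rewrite !inE.
    do 7?[case/orP]; move=> /eqP-> h //; exfalso; lia.
  + rewrite (_ : - -1 * 2 * (4 * c + 3) - (q * 8 + r) = (c - q) * 8 + (6 - r)); last by ring.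
    rewrite chi8_modE; move: hr h; rewrite !inE.
    do 7?[case/orP]; move=> /eqP-> h //; exfalso; lia.
- rewrite ey chi8_modE => h.
  have -> : - mu * 2 ^+ 2 * (4 * c + 3) - (q * 8 + r) =
      (- 2 * mu * c - mu - q) * 8 + (- 4 * mu - r) by ring.
  rewrite chi8_modE; case: hmu h => -> h; move: hr h; rewrite !inE;
    do 7?[case/orP]; move=> /eqP-> h //; exfalso; lia.
- rewrite mul1r => _; rewrite ey chi8_modE (_ : _ - _ =
    (- mu * 2 ^+ d * (4 * c + 3) - q) * 8 + - r); last by rewrite !exprS; ring.
  by rewrite chi8_modE chi8N.
Qed.

(** * Parameters of a matrix and their change under unipotent factors *)

Section DoubleCosets.

Variables (k l : nat) (mu : int) (lk : (l < k)%N) (hmu : mu = 1 \/ mu = -1).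

Local Notation C1_of b x c := (- mu * 2 ^+ (k - l) * (4 * c + 3) - b * x).

Definition has_params (g : 'M[int]_3) (i : nat) (b x c : int) : Prop :=
  has_coords g (2 ^+ k) (2 ^+ i * b) (C1_of b x c) (mu * 2 ^+ l)
    (mu * 2 ^+ (l - 2 - i) * x) (4 * c + 3).

Let mulmu (y : int) : mu * (mu * y) = y.
Proof. by case: hmu => ->; rewrite ?mul1r // !mulN1r opprK. Qed.

Let pow_neq0 (n : nat) : 2 ^+ n != 0 :> int.
Proof. by rewrite expf_neq0. Qed.

Let mu_neq0 : mu != 0.
Proof. by case: hmu => ->. Qed.

Let pow_l (i : nat) : (i < l.-1)%N -> 2 ^+ l = 4 * (2 ^+ i * 2 ^+ (l - 2 - i)) :> int.
Proof. by move=> il; rewrite -exprD (_ : 4 = 2 ^+ 2) // -exprD; congr (_ ^+ _); lia. Qed.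

Let pow_k : 2 ^+ k = 2 ^+ l * 2 ^+ (k - l) :> int.
Proof. by rewrite -expr_subnK // ltnW. Qed.

(** C1 and C2 are odd while 4 A1 and 4 A2 are powers of 2 up to sign, so the coprimality conditions
    of [Gamma_exists] hold. *)
Lemma params_exists (i : nat) (b x c : int) : (i < l.-1)%N ->
  odd `|b| -> odd `|x| -> (C1_of b x c = 3 %[mod 4])%Z ->
  exists2 g, Gamma g & has_params g i b x c.
Proof.
move=> il b_odd x_odd hC1; apply: Gamma_exists => //.
- rewrite pow_k (pow_l il).
  rewrite [LHS](_ : _ = 4 * (2 ^+ i * 2 ^+ (l - 2 - i)) * (2 ^+ (k - l) * (4 * c + 3) +
      mu * (b * x) - mu * (mu * (2 ^+ (k - l) * (4 * c + 3))) - mu * (b * x))); last by ring.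
  by rewrite mulmu; ring.
- lia.
- rewrite /coprimez /gcdz abszM abszX -[absz 4]/(2 ^ 2)%N -expnD.
  have odd1 : odd `|C1_of b x c| by lia.
  by apply/eqP; congr Posz; apply/eqP; rewrite -/(coprime _ _) coprime_sym coprimeXl // coprime2n.
- rewrite /coprimez /gcdz !abszM abszX (_ : absz mu = 1%N); last by case: hmu => ->.
  rewrite mul1n -[absz 4]/(2 ^ 2)%N -expnD.
  have odd1 : odd `|4 * c + 3| by lia.
  by apply/eqP; congr Posz; apply/eqP; rewrite -/(coprime _ _) coprime_sym coprimeXl // coprime2n.
Qed.

Lemma params_shift (g : 'M[int]_3) (i : nat) (b x c a b' c' p q r : int) :
  (i < l.-1)%N -> has_params g i b x c ->
  has_params (umx a b' c' *m g *m umx p q r) i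
    (b + p * 2 ^+ (k - i)) (x - r * 2 ^+ (i + 2))
    (c - q * mu * 2 ^+ l - p * mu * 2 ^+ (l - 2 - i) * x + p * r * mu * 2 ^+ l).
Proof.
move=> il /(has_coords_umx a b' c' p q r) hg.
have eB1 : 2 ^+ i * b + p * 2 ^+ k = 2 ^+ i * (b + p * 2 ^+ (k - i)).
  by rewrite (@expr_subnK _ 2 k i); [ring | lia].
have eB2 : mu * 2 ^+ (l - 2 - i) * x - r * (mu * 2 ^+ l) =
    mu * 2 ^+ (l - 2 - i) * (x - r * 2 ^+ (i + 2)).
  by rewrite (pow_l il) exprD; ring.
have eC2 : 4 * c + 3 - 4 * (q * (mu * 2 ^+ l)) - 4 * (p * (mu * 2 ^+ (l - 2 - i) * x)) +
    4 * (p * r * (mu * 2 ^+ l)) =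
    4 * (c - q * mu * 2 ^+ l - p * mu * 2 ^+ (l - 2 - i) * x + p * r * mu * 2 ^+ l) + 3 by ring.
rewrite eB1 eB2 eC2 in hg; have := has_coords_rel hg.
move: hg; set C1' := (C1_of b x c + _ + _).
set b1 := (b + _); set x1 := (x - _); set c1 := (c - _ - _ + _) => hg rel.
(* The shifted C1 is not computed directly: the relation and A2 != 0 determine it from the other
   coordinates, and the right-hand side satisfies the same relation. *)
suff eC1 : C1' = C1_of b1 x1 c1 by rewrite /has_params -eC1.
apply: (mulIf (mulf_neq0 mu_neq0 (pow_neq0 l))).
apply: (addrI (2 ^+ k * (4 * c1 + 3) + 4 * (2 ^+ i * b1) * (mu * 2 ^+ (l - 2 - i) * x1))).
rewrite rel pow_k (pow_l il).
rewrite [RHS](_ : _ = 4 * (2 ^+ i * 2 ^+ (l - 2 - i)) * (2 ^+ (k - l) * (4 * c1 + 3) +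
      mu * (b1 * x1) - mu * (mu * (2 ^+ (k - l) * (4 * c1 + 3))) - mu * (b1 * x1))); last by ring.
by rewrite mulmu; ring.
Qed.

Lemma params_inj (g : 'M[int]_3) (i j : nat) (b x c b' x' c' : int) :
  (i < l.-1)%N -> odd `|b| -> odd `|b'| ->
  has_params g i b x c -> has_params g j b' x' c' ->
  [/\ i = j, b = b', x = x' & c = c'].
Proof.
move=> il b_odd b'_odd /has_coords_pl[[_ hB1 _] [_ hB2 hC2]].
move=> /has_coords_pl[[_ hB1' _] [_ hB2' hC2']].
have [ij bb] := pow2_odd_inj b_odd b'_odd (etrans (esym hB1) hB1').
split=> //; last by have := etrans (esym hC2) hC2'; lia.
have := etrans (esym hB2) hB2'; rewrite -ij; apply: mulfI.
by rewrite mulf_neq0.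
Qed.

Lemma params_double_coset (g h : 'M[int]_3) (i : nat) (b x c : int) :
  \det g = 1 -> \det h = 1 -> has_params g i b x c -> has_params h i b x c ->
  double_coset g h.
Proof.
move=> detg deth [[g20 g21 g22] [m01 m02 m12]] [[h20 h21 h22] [n01 n02 n12]].
have h2 j : h 2 j = g 2 j.
  by elim/ord3_ind: j; rewrite ?g20 ?g21 ?g22 ?h20 ?h21 ?h22.
rewrite !h2 in n01 n02 n12.
have [u hu ->] := plucker_row_eq detg deth h2 (etrans n12 (esym m12))
  (etrans n02 (esym m02)) (etrans n01 (esym m01)).
exists u => //; exists (umx 0 0 0); first exact: umx_unipotent.
by rewrite umx0 mulmx1.
Qed.

(** [split_value] after C1 is eliminated by [chi8_C1], so that [b], [x] and [c] occur in separate
    factors. *)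
Definition weight (i : nat) (b x c : int) : int :=
  (if (b == 1 %[mod 4])%Z then 1 else - mu) * chi8 b ^+ (k - l + i) *
  kappa mu (k - l) ^+ i * chi8 x ^+ i * chi8 (4 * c + 3) ^+ (l - i).

Lemma splitting_params (g : 'M[int]_3) (i : nat) (b x c : int) :
  (i < l.-1)%N -> odd `|b| -> odd `|x| -> (C1_of b x c = 3 %[mod 4])%Z ->
  has_params g i b x c -> splitting g = weight i b x c.
Proof.
move=> il b_odd x_odd hC1 hg.
rewrite (splitting_eval lk _ hmu b_odd _ _ hg); last 3 first.
- lia.
- lia.
- lia.
rewrite /split_value /weight chi8_C1 // ?subn_gt0 // !exprMn exprD; ring.
Qed.

(** Both 2^(k-i) and 2^(i+2) are divisible by 4, and [c] enters C1 modulo 4 only through 4 c, so any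
    [c'] may replace it. *)
Lemma C1_shift (i : nat) (b x c c' p r : int) : (i < l.-1)%N ->
  (C1_of b x c = 3 %[mod 4])%Z ->
  (C1_of (b + p * 2 ^+ (k - i)) (x - r * 2 ^+ (i + 2)) c' = 3 %[mod 4])%Z.
Proof.
move=> il hC1.
have -> : 2 ^+ (k - i) = 2 ^+ (k - i - 2) * 4 :> int.
  by rewrite (_ : 4 = 2 ^+ 2) // -exprD; congr (_ ^+ _); lia.
rewrite exprD -[RHS]hC1.
rewrite (_ : C1_of (b + _) _ _ = (- mu * 2 ^+ (k - l) * (c' - c) -
    (p * 2 ^+ (k - i - 2) * x - b * r * 2 ^+ i - 4 * p * r * 2 ^+ (k - i - 2) * 2 ^+ i)) * 4 +
    C1_of b x c) ?modzMDl //.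
by rewrite (_ : 2 ^+ 2 = 4) //; ring.
Qed.

(** The shift of [b] is divisible by 8 since k - i >= 3. That of [x] is divisible by 8 unless i = 0,
    when the exponent of [chi8 x] is 0. That of [c] is even, as the factor in [c] requires, unless i
    = l - 2, when its exponent l - i is 2 and the square is 1. *)
Lemma weight_shift (i : nat) (b x c p q r : int) : (i < l.-1)%N -> odd `|x| ->
  weight i (b + p * 2 ^+ (k - i)) (x - r * 2 ^+ (i + 2))
    (c - q * mu * 2 ^+ l - p * mu * 2 ^+ (l - 2 - i) * x + p * r * mu * 2 ^+ l) =
  weight i b x c.
Proof.
move=> il x_odd; rewrite /weight.
have -> : 2 ^+ (k - i) = 2 ^+ (k - i - 3) * 8 :> int.
  by rewrite (_ : 8 = 2 ^+ 3) // -exprD; congr (_ ^+ _); lia.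
rewrite (_ : b + _ = (p * 2 ^+ (k - i - 3)) * 8 + b) ?chi8_modE; last by ring.
rewrite (_ : ((_ * 8 + b)%R == _ %[mod 4])%Z = (b == 1 %[mod 4])%Z); last by lia.
have -> : chi8 (x - r * 2 ^+ (i + 2)) ^+ i = chi8 x ^+ i.
  case: i {il} => // i; rewrite (_ : x - _ = (- r * 2 ^+ i) * 8 + x) ?chi8_modE //.
  by rewrite exprD exprS; ring.
congr (_ * _).
have [w ->] : exists w, 2 ^+ l = 2 * w :> int by exists (2 ^+ l.-1); rewrite -exprS prednK //; lia.
case: (posnP (l - 2 - i)) => [il2|il2].
  have -> : (l - i = 2)%N by lia.
  have sq (z : int) : odd `|z| -> chi8 z ^+ 2 = 1.
    move=> z_odd; have [t [s ez hs]] := divz_eq8 z; move: z_odd.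
    rewrite ez chi8_modE; move: hs; rewrite !inE.
    by do 7?[case/orP]; move=> /eqP-> h //; exfalso; lia.
  by rewrite !sq //; lia.
rewrite -(prednK il2) exprS.
set t := 2 ^+ _.
rewrite (_ : 4 * _ + 3 = (- q * mu * w - p * mu * t * x + p * r * mu * w) * 8 + (4 * c + 3)).
  by rewrite chi8_modE.
by ring.
Qed.

End DoubleCosets.

(** * Exponential sums *)

Section ExponentialSums.

Variable R : realType.

Lemma cexp2piD (s t : R) : cexp2pi (s + t) = cexp2pi s * cexp2pi t.
Proof.
rewrite /cexp2pi mulrDr cosD sinD; apply/eqP; rewrite eq_complex /=.
by rewrite eqxx /= addrC.
Qed.

Lemma cexp2pi0 : cexp2pi (0 : R) = 1.
Proof. by rewrite /cexp2pi mulr0 cos0 sin0. Qed.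

Lemma cexp2pi_nat (n : nat) : cexp2pi (n%:R : R) = 1.
Proof.
elim: n => [|n IHn]; first exact: cexp2pi0.
rewrite -natr1 cexp2piD IHn mul1r /cexp2pi mulr1 mulr_natl.
by rewrite cos2pi sin2pi.
Qed.

Lemma cexp2pi_int (z : int) : cexp2pi (z%:~R : R) = 1.
Proof.
case: z => n; first exact: cexp2pi_nat.
by rewrite NegzE -[LHS]mulr1 -{1}(cexp2pi_nat n.+1) -cexp2piD mulrNz addNr cexp2pi0.
Qed.

Lemma cexp2piDint (s : R) (z : int) : cexp2pi (s + z%:~R) = cexp2pi s.
Proof. by rewrite cexp2piD cexp2pi_int mulr1. Qed.

Lemma chi8_odd_expr (x : int) (m n : nat) : odd `|x| -> odd m = odd n ->
  chi8 x ^+ m = chi8 x ^+ n.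
Proof.
move=> x_odd mn; have : chi8 x = 1 \/ chi8 x = -1.
  have [t [s ez hs]] := divz_eq8 x; move: x_odd.
  rewrite ez chi8_modE; move: hs; rewrite !inE.
  by do 7?[case/orP]; move=> /eqP-> h //; (try by [left|right]); exfalso; lia.
by case=> ->; rewrite ?expr1n // -signr_odd mn signr_odd.
Qed.

(** On odd arguments [chi8] is a sign, so the exponent matters only through its parity; the freedom
    in [j'] lets the exponents found in [weight] be matched with k and l. *)
Lemma gsumE (eps m : int) (j j' n : nat) : (0 < n)%N -> odd `|eps| -> odd j = odd j' ->
  gsum R eps (2 ^ j) m (2 ^ n) =
  \sum_(x < 2 ^ n | (x%:Z == eps %[mod 4])%Z)
    (chi8 x%:Z ^+ j')%:~R * cexp2pi ((m * x%:Z)%:~R / 2 ^+ n : R).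
Proof.
move=> n0 eps_odd jj; rewrite /gsum big_mkord.
have x_odd (x : nat) : (x%:Z == eps %[mod 4])%Z -> odd x by move=> /eqP; lia.
apply: eq_big => [x|x /andP[_ hx]].
  apply/andP/idP => [[]//|hx]; split=> //.
  by rewrite coprime_sym coprimeXl // coprime2n x_odd.
rewrite natrX; congr (_%:~R * _).
rewrite Posz_pow2 -[2 ^+ j]mul1r kronecker_pow2; last by left.
by rewrite /= mul1r; apply: chi8_odd_expr => //; exact: x_odd.
Qed.

(** [chi8 (4 * c + 3)] alternates in sign with [c], so consecutive terms cancel for odd [j]; the
    length 2^n is even because n > 0. *)
Lemma sum_chi8_3mod4 (n j : nat) : (0 < n)%N ->
  \sum_(c < 2 ^ n) chi8 (4 * c%:Z + 3) ^+ j = if odd j then 0 else 2 ^+ n.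
Proof.
move=> n0.
have chiE (c : nat) : chi8 (4 * c%:Z + 3) = (-1) ^+ c.+1.
  have e : c%:Z = 2 * c./2%:Z + odd c by lia.
  rewrite e (_ : 4 * _ + 3 = c./2%:Z * 8 + (4 * (odd c)%:Z + 3)) ?chi8_modE; last by ring.
  by rewrite -signr_odd /=; case: (odd c).
case: ifP => j_odd.
  have -> : (2 ^ n = (2 ^ n.-1).*2)%N by rewrite -mul2n -expnS prednK.
  elim: (2 ^ n.-1)%N => [|m IHm]; first by rewrite big_ord0.
  rewrite doubleS !big_ord_recr /= IHm add0r !chiE -!exprM.
  rewrite -signr_odd -[X in _ + X]signr_odd !oddM /= j_odd odd_double /=.
  by [].
rewrite -Posz_pow2 (eq_bigr (fun=> 1)) => [|c _].
  by rewrite sumr_const card_ord natz.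
by rewrite chiE -exprM -signr_odd oddM j_odd andbF.
Qed.

End ExponentialSums.

Lemma modz_pow2 (n : nat) (y : int) :
  exists2 z : 'I_(2 ^ n), z%:Z = (y %% 2 ^+ n)%Z & odd `|y| -> (0 < n)%N -> odd z.
Proof.
have pow_gt0 : 0 < 2 ^+ n :> int by rewrite exprn_gt0.
have pow_neq0 : 2 ^+ n != 0 :> int by rewrite gt_eqF.
have hz : (absz (y %% 2 ^+ n)%Z < 2 ^ n)%N.
  by rewrite -ltz_nat Posz_pow2 gez0_abs ?modz_ge0 // ltz_pmod.
exists (Ordinal hz); rewrite /= ?gez0_abs ?modz_ge0 //.
case: n {pow_gt0 pow_neq0 hz} => // n y_odd _.
have := divz_eq y (2 ^+ n.+1); move: (y %/ _)%Z (y %% _)%Z => u v.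
by rewrite exprS mulrCA; move: (u * _) => w; lia.
Qed.

(** * Reduction of the Kloosterman sum to a finite sum over parameters *)

Section KloostermanSum.

Variables (R : realType) (k l : nat) (mu m1 m2 : int).
Hypotheses (lk : (l < k)%N) (l2 : (2 <= l)%N) (hmu : mu = 1 \/ mu = -1).

(** The parameters are reduced representatives. The last congruence is C1 = 3 mod 4, stated without
    [c], which enters C1 only through 4 c. *)
Definition valid (i b x : nat) : bool :=
  [&& (i < l.-1)%N, (b < 2 ^ (k - i))%N, (x < 2 ^ (i + 2))%N, odd b, odd x
    & (b%:Z * x%:Z == 1 + mu * 2 ^+ (k - l) %[mod 4])%Z].

Lemma valid_C1 (i b x : nat) (c : int) : valid i b x ->
  ((- mu * 2 ^+ (k - l) * (4 * c + 3) - b%:Z * x%:Z)%R = 3 %[mod 4])%Z.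
Proof.
case/and5P=> _ _ _ _ /andP[_ /eqP]; move: (b%:Z * x%:Z) => y hy.
rewrite (_ : _ - y = - (mu * 2 ^+ (k - l)) * c * 4 - (3 * (mu * 2 ^+ (k - l)) + y)); last by ring.
by rewrite modzMDl; move: hy; move: (mu * _) => z; lia.
Qed.

(** After cancellation of powers of 2 and of mu, B1/A1 = b/2^(k-i) and B2/A2 = x/2^(i+2). *)
Definition phase (i : nat) (b x : int) : R[i] :=
  cexp2pi ((m1 * b)%:~R / 2 ^+ (k - i) + (m2 * x)%:~R / 2 ^+ (i + 2)).

Lemma phase_shift (i : nat) (b x p r : int) :
  phase i (b + p * 2 ^+ (k - i)) (x - r * 2 ^+ (i + 2)) = phase i b x.
Proof.
have pow0 n : 2 ^+ n != 0 :> R by rewrite expf_neq0 // pnatr_eq0.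
rewrite /phase -[RHS](cexp2piDint _ (m1 * p - m2 * r)); congr cexp2pi.
rewrite !(rmorphD, rmorphN, rmorphM, rmorphXn) /=.
by field; rewrite !pow0.
Qed.

Lemma cexp2pi_params (g : 'M[int]_3) (i : nat) (b x c : int) : (i < l.-1)%N ->
  has_params k l mu g i b x c ->
  cexp2pi ((m1 * plB1 g)%:~R / (2 ^+ k)%:~R +
    (m2 * plB2 g)%:~R / (mu * 2 ^+ l)%:~R : R) = phase i b x.
Proof.
move=> il /has_coords_pl[[_ -> _] [_ -> _]]; rewrite /phase; congr (cexp2pi (_ + _)).
  have pow0 n : 2 ^+ n != 0 :> R by rewrite expf_neq0 // pnatr_eq0.
  rewrite (@expr_subnK _ 2 k i); last by lia.
  by rewrite !intrM !rmorphXn /=; field; rewrite !pow0.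
have pow0 n : 2 ^+ n != 0 :> R by rewrite expf_neq0 // pnatr_eq0.
have -> : 2 ^+ l = 2 ^+ (i + 2) * 2 ^+ (l - 2 - i) :> int by rewrite -exprD; congr (_ ^+ _); lia.
have mu0 : mu%:~R != 0 :> R by rewrite intr_eq0; case: hmu => ->.
by rewrite !intrM !rmorphXn /=; field; rewrite mu0 !pow0.
Qed.

(** The ranges of b and x depend on i; the common bounds 2^k and 2^l give a plain product type,
    which [validJ] cuts down. *)
Let J := ('I_l * 'I_(2 ^ k) * 'I_(2 ^ l) * 'I_(2 ^ l))%type.

(** A chosen matrix with parameters [j]. The default 0 never occurs for valid [j], by
    [params_exists]. *)
Definition rep (j : J) : 'M[int]_3 := xget 0 [set g | Gamma g /\
  has_params k l mu g j.1.1.1 j.1.1.2%:Z j.1.2%:Z j.2%:Z]%classic.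

Definition validJ (j : J) : bool := valid j.1.1.1 j.1.1.2 j.1.2.

Lemma repP (j : J) : validJ j -> Gamma (rep j) /\
  has_params k l mu (rep j) j.1.1.1 j.1.1.2%:Z j.1.2%:Z j.2%:Z.
Proof.
move=> hj; have hC1 := valid_C1 j.2 hj.
case/and5P: (hj) => il _ _ b_odd /andP[x_odd _].
have [g Gg hg] := @params_exists k l mu lk hmu _ j.1.1.2%:Z j.1.2%:Z j.2%:Z il b_odd x_odd hC1.
by rewrite /rep; case: xgetP => // /(_ g) []; split.
Qed.

Lemma rep_SSet (j : J) : validJ j -> SSet (2 ^+ k) (mu * 2 ^+ l) (rep j).
Proof. by case/repP=> Gg /has_coords_pl[[eA1 _ _] [eA2 _ _]]; split. Qed.

Lemma det_umx p q r : \det (umx p q r) = 1.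
Proof. by rewrite det3 !mxE /=; ring. Qed.

Lemma SSet_rep (g : 'M[int]_3) : SSet (2 ^+ k) (mu * 2 ^+ l) g ->
  exists2 j, validJ j & double_coset g = double_coset (rep j).
Proof.
move=> hg; have [i [b [x [c [il b_odd x_odd hC1 hp]]]]] := SSet_coords lk hmu hg.
have pow_gt0 n : 0 < 2 ^+ n :> int by rewrite exprn_gt0.
have pow_neq0 n : 2 ^+ n != 0 :> int by rewrite gt_eqF.
(* [p] and [r] reduce b modulo 2^(k-i) and x modulo 2^(i+2). This moves c to [c1], which [q] then
   reduces modulo 2^l, using mu^2 = 1. *)
pose p := - (b %/ 2 ^+ (k - i))%Z; pose r := (x %/ 2 ^+ (i + 2))%Z.
pose c1 := c - p * mu * 2 ^+ (l - 2 - i) * x + p * r * mu * 2 ^+ l.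
pose q := mu * (c1 %/ 2 ^+ l)%Z.
have := params_shift lk hmu 0 0 0 p q r il hp.
have := C1_shift lk hmu (c1 %% 2 ^+ l)%Z p r il hC1.
set g' := (_ *m _ *m _).
have -> : b + p * 2 ^+ (k - i) = (b %% 2 ^+ (k - i))%Z by rewrite /p /modz mulNr.
have -> : x - r * 2 ^+ (i + 2) = (x %% 2 ^+ (i + 2))%Z by [].
have -> : c - q * mu * 2 ^+ l - p * mu * 2 ^+ (l - 2 - i) * x + p * r * mu * 2 ^+ l =
    (c1 %% 2 ^+ l)%Z.
  by rewrite /modz /q /c1; move: (c1 %/ _)%Z => z; case: hmu => ->; ring.
have [zb eb ob] := modz_pow2 (k - i)%N b; have [zx ex ox] := modz_pow2 (i + 2)%N x.
have [zc ec _] := modz_pow2 l c1.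
rewrite -eb -ex -ec => hC1' hp'.
have il' : (i < l)%N by clear -il; lia.
have ki : (0 < k - i)%N by clear -il' lk; lia.
have i0 : (0 < i + 2)%N by rewrite addn2.
have lb : (zb < 2 ^ k)%N by apply: leq_trans (ltn_ord zb) _; rewrite leq_exp2l // leq_subr.
have lx : (zx < 2 ^ l)%N by apply: leq_trans (ltn_ord zx) _; rewrite leq_exp2l //; clear -il; lia.
pose j : J := (Ordinal il', Ordinal lb, Ordinal lx, zc).
have hj : validJ j.
  rewrite /validJ /valid /= il !ltn_ord ob // ox //=.
  apply/eqP; move: hC1'; move: (zb%:Z * zx%:Z) => y hy.
  move: hy; rewrite (_ : _ - y = - (mu * 2 ^+ (k - l)) * zc * 4 - (3 * (mu * 2 ^+ (k - l)) + y));
    last by ring.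
  by rewrite modzMDl; move: (mu * _) => z; clear; lia.
have [[detr _] hr] := repP hj.
exists j => //.
have gg' : double_coset g g' by apply/double_cosetP; exists 0, 0, 0, p, q, r.
rewrite (double_coset_eq gg'); apply: double_coset_eq.
apply: params_double_coset hp' hr => //.
by rewrite /g' !det_mulmx !det_umx mul1r mulr1; case: hg => -[].
Qed.

(** Equal double cosets give parameters related by [params_shift], and reduced representatives leave
    no room for a shift: first [p] and [r] vanish, and only then does the equation for [c] force
    [q * mu] to vanish. *)
Lemma rep_inj (j j' : J) : validJ j -> validJ j' ->
  double_coset (rep j) = double_coset (rep j') -> j = j'.
Proof.
move=> hj hj' e; have [_ hr] := repP hj; have [_ hr'] := repP hj'.
have : double_coset (rep j) (rep j') by rewrite e; exact: double_coset_refl.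
move=> /double_cosetP[a [b [c [p [q [r er]]]]]].
case/and5P: (hj) => il bk xl b_odd /andP[x_odd _].
case/and5P: (hj') => il' bk' xl' b_odd' /andP[x_odd' _].
have := params_shift lk hmu a b c p q r il hr; rewrite -er => hs.
have pow_gt0 n : 0 < 2 ^+ n :> int by rewrite exprn_gt0.
have b_odd1 : odd `|j.1.1.2%:Z + p * 2 ^+ (k - j.1.1.1)|.
  rewrite -(@prednK (k - j.1.1.1)) ?exprS; last by clear -il lk; lia.
  by rewrite mulrCA; move: (p * _) => w; clear -b_odd; lia.
have [ei eb ex ec] := params_inj lk hmu (b := j'.1.1.2%:Z) il' b_odd' b_odd1 hr' hs.
have small (n : nat) (y z : nat) (t : int) : (y < 2 ^ n)%N -> (z < 2 ^ n)%N ->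
    y%:Z = z%:Z + t * 2 ^+ n -> t = 0.
  rewrite -!ltz_nat Posz_pow2; move: (2 ^+ n) (pow_gt0 n) => w w0 yw zw e1.
  by clear -w0 yw zw e1; nia.
rewrite -ei in bk xl.
have p0 : p = 0 by apply: small bk' bk _; rewrite eb ei.
have r0 : - r = 0 by apply: small xl' xl _; rewrite ex ei mulNr.
have {}r0 : r = 0 by rewrite -[r]opprK r0 oppr0.
rewrite p0 r0 !mul0r subr0 addr0 in eb ex ec.
have q0 : - (q * mu) = 0.
  by apply: small (ltn_ord j'.2) (ltn_ord j.2) _; rewrite ec ?mul0r ?subr0 ?addr0 mulNr.
have {}q0 : q * mu = 0 by rewrite -[q * mu]opprK q0 oppr0.
rewrite q0 ?mul0r ?subr0 ?addr0 in ec.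
have i_eq : j'.1.1.1 = j.1.1.1 by apply: val_inj.
have b_eq : j'.1.1.2 = j.1.1.2 by apply: val_inj; case: eb.
have x_eq : j'.1.2 = j.1.2 by apply: val_inj; case: ex.
have c_eq : j'.2 = j.2 by apply: val_inj; case: ec.
move: i_eq b_eq x_eq c_eq; clear.
by case: j j' => [[[i b] x] c] [[[i' b'] x'] c'] /= -> -> -> ->.
Qed.

Definition summand (g : 'M[int]_3) : R[i] := (splitting g)%:~R *
  cexp2pi ((m1 * plB1 g)%:~R / (2 ^+ k)%:~R + (m2 * plB2 g)%:~R / (mu * 2 ^+ l)%:~R : R).

Definition weightJ (j : J) : int :=
  weight k l mu j.1.1.1 j.1.1.2%:Z j.1.2%:Z j.2%:Z.

(** [Sigma] evaluates the summand at an arbitrarily chosen element of each double coset, so the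
    value must be known on the whole coset and not only at [rep j]. *)
Lemma summand_rep (j : J) (g : 'M[int]_3) : validJ j -> double_coset (rep j) g ->
  summand g = (weightJ j)%:~R * phase j.1.1.1 j.1.1.2%:Z j.1.2%:Z.
Proof.
move=> hj /double_cosetP[a [b [c [p [q [r eg]]]]]].
have [_ hr] := repP hj; have hC1 := valid_C1 j.2 hj.
case/and5P: (hj) => il _ _ b_odd /andP[x_odd _].
have := params_shift lk hmu a b c p q r il hr; rewrite -eg => hg.
rewrite /summand (cexp2pi_params il hg) phase_shift; congr (_%:~R * _).
have hC1' := C1_shift lk hmu _ p r il hC1.
have b_odd' : odd `|j.1.1.2%:Z + p * 2 ^+ (k - j.1.1.1)|.
  rewrite -(@prednK (k - j.1.1.1)) ?exprS; last by clear -il lk; lia.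
  by rewrite mulrCA; move: (p * _) => w; clear -b_odd; lia.
have x_odd' : odd (absz (j.1.2%:Z - r * 2 ^+ (j.1.1.1 + 2))%R).
  by rewrite addn2 exprS mulrCA; move: (r * _) => w; clear -x_odd; lia.
by rewrite (splitting_params lk hmu il b_odd' x_odd' (hC1' _) hg) (weight_shift lk hmu).
Qed.

Lemma Sigma_sum : Sigma R (2 ^+ k) (mu * 2 ^+ l) m1 m2 =
  \sum_(j : J | validJ j) (weightJ j)%:~R * phase j.1.1.1 j.1.1.2%:Z j.1.2%:Z.
Proof.
pose X (j : J) := double_coset (rep j).
have imE : [set double_coset g | g in SSet (2 ^+ k) (mu * 2 ^+ l)]%classic =
    (X @` [set` validJ])%classic.
  apply/seteqP; split => [_ [g /SSet_rep[j hj ->] <-]|_ [j hj <-]].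
    by exists j.
  by exists (rep j) => //; exact: rep_SSet.
(* Injectivity of the map from valid [j] to double cosets turns the sum over cosets into a sum over
   [validJ]. *)
rewrite /Sigma imE fsbig_image; last first.
  by move=> j j'; rewrite !inE; exact: rep_inj.
rewrite [RHS]bigfs ?index_enum_uniq //; last first.
  by move=> j _; rewrite mem_index_enum.
apply: eq_fsbigr => j; rewrite inE => hj.
rewrite -(@summand_rep j (xget 0 (X j))) //.
by apply: (xgetPex 0 (P := X j)); exists (rep j); exact: double_coset_refl.
Qed.
End KloostermanSum.

(** If b x = d mod 4, then x is d for b = 1 and -d for b = -1 mod 4, so the double sum splits into
    two products of independent sums. All conditions depend on residues mod 4 only and are checked
    exhaustively. *)
Lemma sum_mod4 (T : comNzRingType) (N M : nat) (d mu : int) (f g : nat -> T) :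
  d = 1 \/ d = -1 ->
  \sum_(b < N) \sum_(x < M)
    (if [&& odd b, odd x & (b%:Z * x%:Z == d %[mod 4])%Z] then
       (if (b%:Z == 1 %[mod 4])%Z then 1 else - mu)%:~R * (f b * g x) else 0) =
  (\sum_(b < N | (b%:Z == 1 %[mod 4])%Z) f b) *
  (\sum_(x < M | (x%:Z == d %[mod 4])%Z) g x) +
  (- mu)%:~R * ((\sum_(b < N | (b%:Z == -1 %[mod 4])%Z) f b) *
                (\sum_(x < M | (x%:Z == - d %[mod 4])%Z) g x)).
Proof.
move=> hd.
have distr (e e' : int) : (\sum_(b < N | (b%:Z == e %[mod 4])%Z) f b) *
    (\sum_(x < M | (x%:Z == e' %[mod 4])%Z) g x) =
    \sum_(b < N) \sum_(x < M) (if (b%:Z == e %[mod 4])%Z && (x%:Z == e' %[mod 4])%Z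
      then f b * g x else 0).
  rewrite big_distrlr /= big_mkcond; apply: eq_bigr => b _.
  case: ifP => hb; first by rewrite big_mkcond.
  by rewrite big1.
rewrite !distr mulr_sumr -big_split /=; apply: eq_bigr => b _.
rewrite mulr_sumr -big_split /=; apply: eq_bigr => x _.
move: (f b) (g x) => u v.
have mod4 (n : nat) : exists q, n = (q * 4 + 0)%N \/ n = (q * 4 + 1)%N \/ n = (q * 4 + 2)%N \/
    n = (q * 4 + 3)%N.
  by exists (n %/ 4)%N; clear; lia.
have bxE (q t r s : nat) : ((q * 4 + r)%N%:Z * (t * 4 + s)%N%:Z == d %[mod 4])%Z =
    (r%:Z * s%:Z == d %[mod 4])%Z.
  rewrite (_ : _ * _ = (q%:Z * t%:Z * 4 + q%:Z * s%:Z + r%:Z * t%:Z) * 4 + r%:Z * s%:Z).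
    by rewrite modzMDl.
  by rewrite !PoszD !PoszM; ring.
have bE (q r : nat) (e : int) : ((q * 4 + r)%N%:Z == e %[mod 4])%Z = (r%:Z == e %[mod 4])%Z.
  by rewrite PoszD PoszM modzMDl.
have oE (q r : nat) : odd (q * 4 + r) = odd r by rewrite oddD oddM andbF.
have [q eb] := mod4 b; have [t ex] := mod4 x.
by case: eb => [|[|[|]]] ->; case: ex => [|[|[|]]] ->; rewrite !bxE !bE !oE; case: hd => ->;
  rewrite /= ?mulr0 ?addr0 ?add0r ?mul1r.
Qed.

(** * Evaluation of the finite sum by the sums g_eps *)

Section FinalFormula.

Variables (R : realType) (k l : nat) (mu m1 m2 : int).
Hypotheses (lk : (l < k)%N) (l2 : (2 <= l)%N) (hmu : mu = 1 \/ mu = -1).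

(** Common form of the three formulas: [d] is the residue of b x mod 4, namely 1 for k - l >= 2 and
    -1 for k - l = 1, and [kappa] supplies the sign that ends up in front. *)
Lemma Sigma_gsum (d : int) : d = 1 \/ d = -1 ->
  (1 + mu * 2 ^+ (k - l) == d %[mod 4])%Z ->
  Sigma R (2 ^+ k) (mu * 2 ^+ l) m1 m2 =
  2 ^+ l * \sum_(0 <= i < l.-1 | (i == l %[mod 2])%N) (kappa mu (k - l))%:~R ^+ i *
    (gsum R 1 (2 ^ k) m1 (2 ^ (k - i)) * gsum R d (2 ^ l) m2 (2 ^ (i + 2)) +
     (- mu)%:~R * (gsum R (-1) (2 ^ k) m1 (2 ^ (k - i)) *
                   gsum R (- d) (2 ^ l) m2 (2 ^ (i + 2)))).
Proof.
move=> hd hdelta; rewrite Sigma_sum // big_mkcond.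
pose f (i b : nat) : R[i] := (chi8 b%:Z ^+ (k - l + i))%:~R *
  cexp2pi ((m1 * b%:Z)%:~R / 2 ^+ (k - i) : R).
pose g (i x : nat) : R[i] := (chi8 x%:Z ^+ i)%:~R *
  cexp2pi ((m2 * x%:Z)%:~R / 2 ^+ (i + 2) : R).
pose F (i b x : nat) : R[i] :=
  if [&& odd b, odd x & (b%:Z * x%:Z == d %[mod 4])%Z] then
       (if (b%:Z == 1 %[mod 4])%Z then 1 else - mu)%:~R * (f i b * g i x) else 0.
transitivity (\sum_(i < l) \sum_(b < 2 ^ k) \sum_(x < 2 ^ l) \sum_(c < 2 ^ l)
  (if valid k l mu i b x then (weight k l mu i b%:Z x%:Z c%:Z)%:~R * phase R k m1 m2 i b%:Z x%:Z
   else 0 : R[i])).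
  by rewrite !pair_bigA /=; apply: eq_bigr => -[[[i b] x] c].
(* Only the factor in [chi8 (4 * c + 3)] depends on c, so [sum_chi8_3mod4] leaves 2^l if i = l mod 2
   and 0 otherwise. The nested conditions keep the ranges of b and x apart. *)
have sum_c (i : 'I_l) (b : 'I_(2 ^ k)) (x : 'I_(2 ^ l)) : \sum_(c < 2 ^ l)
    (if valid k l mu i b x then (weight k l mu i b%:Z x%:Z c%:Z)%:~R * phase R k m1 m2 i b%:Z x%:Z
     else 0 : R[i]) =
   if (i == l %[mod 2])%N && (i < l.-1)%N then
     if (b < 2 ^ (k - i))%N then
       if (x < 2 ^ (i + 2))%N then
     2 ^+ l * (kappa mu (k - l))%:~R ^+ i * F i b x else 0 else 0 else 0.
  rewrite /valid (eqP hdelta).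
  case: ltnP => [il|_]; last by rewrite andbF big1.
  case: ltnP => [bk|_] /=; last by rewrite big1 ?if_same.
  case: ltnP => [xl|_] /=; last by rewrite big1 ?if_same.
  rewrite andbT /F; case: [&& odd b, odd x & (b%:Z * x%:Z == d %[mod 4])%Z];
    last by rewrite big1 // mulr0 if_same.
  rewrite -mulr_suml -rmorph_sum /= /weight -mulr_sumr sum_chi8_3mod4; last by lia.
  rewrite (_ : odd (l - i) = ~~ (i == l %[mod 2])%N); last by lia.
  case: (i == l %[mod 2])%N => /=; last by rewrite mulr0 mul0r.
  rewrite /phase cexp2piD /f /g !rmorphM !rmorphXn /=; ring.
(* The common ranges 2^k and 2^l shrink back to the true ranges 2^(k-i) and 2^(i+2). *)
transitivity (\sum_(i < l) if (i == l %[mod 2])%N && (i < l.-1)%N then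
    2 ^+ l * (kappa mu (k - l))%:~R ^+ i *
      \sum_(b < 2 ^ (k - i)) \sum_(x < 2 ^ (i + 2)) F i b x else 0).
  apply: eq_bigr => i _.
  under eq_bigr => b _ do under eq_bigr => x _ do rewrite sum_c.
  case: ifP => [/andP[_ il]|_]; last by rewrite big1 // => b _; rewrite big1.
  rewrite mulr_sumr.
  rewrite [RHS](big_ord_widen (2 ^ k) (fun b => 2 ^+ l * _ * \sum_(x < _) F i b x)); last first.
    by rewrite leq_exp2l // leq_subr.
  rewrite [RHS]big_mkcond; apply: eq_bigr => b _.
  case: ifP => _; last by rewrite big1.
  rewrite mulr_sumr [RHS](big_ord_widen (2 ^ l) (fun x => 2 ^+ l * _ * F i b x)); last first.
    by rewrite leq_exp2l //; lia.
  by rewrite [RHS]big_mkcond.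
rewrite -big_mkcond -(big_ord_widen_cond l (fun i => i == l %[mod 2])%N (fun i => 2 ^+ l * _ ^+ i *
  \sum_(b < 2 ^ (k - i)) \sum_(x < 2 ^ (i + 2)) F i b x)) ?leq_pred //.
rewrite mulr_sumr big_mkord; apply: eq_bigr => i /eqP hi.
have il := ltn_ord i.
rewrite -mulrA /F sum_mod4 //.
have d_odd : odd `|d| by case: hd => ->.
have Nd_odd : odd `|- d| by case: hd => ->.
(* For i = l mod 2 the exponents k - l + i and i have the parities of k and l. *)
by rewrite !(@gsumE _ _ _ k (k - l + i)) ?(@gsumE _ _ _ l i) //; lia.
Qed.

End FinalFormula.

(** [kappa] is a sign, so its power is the same for all i of the parity of l and leaves the sum as a
    common factor, the source of (-1)^l and (-mu)^l. *)
Lemma kappa_expr (T : pzRingType) (mu : int) (d i l : nat) :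
  mu = 1 \/ mu = -1 -> (i = l %[mod 2])%N ->
  (kappa mu d)%:~R ^+ i = (kappa mu d)%:~R ^+ l :> T.
Proof.
move=> hmu hi; have odd_il : odd i = odd l by lia.
have : kappa mu d = 1 \/ kappa mu d = -1.
  rewrite /kappa; case: ifP => _; first by case: hmu => ->; [right|left].
  by case: ifP => _; [right|left].
by case=> ->; rewrite ?expr1n // -signr_odd odd_il signr_odd.
Qed.

Theorem proposition24 (R : realType) (k l : nat) (m1 m2 mu : int)
    (hkl : (l < k)%N) (hmu : mu = 1 \/ mu = -1) :
  [/\ (l = 0%N \/ l = 1%N ->
        Sigma R (2 ^+ k) (mu * 2 ^+ l) m1 m2 = 0),
      ((2 <= l)%N -> (3 <= k - l)%N ->
        Sigma R (2 ^+ k) (mu * 2 ^+ l) m1 m2 =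
        2 ^+ l * \sum_(0 <= i < l.-1 | (i == l %[mod 2])%N)
          (gsum R 1 (2 ^ k) m1 (2 ^ (k - i)) *
             gsum R 1 (2 ^ l) m2 (2 ^ (i + 2)) +
           (- mu)%:~R *
             (gsum R (-1) (2 ^ k) m1 (2 ^ (k - i)) *
              gsum R (-1) (2 ^ l) m2 (2 ^ (i + 2))))),
      ((2 <= l)%N -> (k - l = 2)%N ->
        Sigma R (2 ^+ k) (mu * 2 ^+ l) m1 m2 =
        (-1) ^+ l * 2 ^+ l * \sum_(0 <= i < l.-1 | (i == l %[mod 2])%N)
          (gsum R 1 (2 ^ k) m1 (2 ^ (k - i)) *
             gsum R 1 (2 ^ l) m2 (2 ^ (i + 2)) +
           (- mu)%:~R *
             (gsum R (-1) (2 ^ k) m1 (2 ^ (k - i)) *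
              gsum R (-1) (2 ^ l) m2 (2 ^ (i + 2)))))
    & ((2 <= l)%N -> (k - l = 1)%N ->
        Sigma R (2 ^+ k) (mu * 2 ^+ l) m1 m2 =
        (- mu)%:~R ^+ l * 2 ^+ l * \sum_(0 <= i < l.-1 | (i == l %[mod 2])%N)
          (gsum R 1 (2 ^ k) m1 (2 ^ (k - i)) *
             gsum R (-1) (2 ^ l) m2 (2 ^ (i + 2)) +
           (- mu)%:~R *
             (gsum R (-1) (2 ^ k) m1 (2 ^ (k - i)) *
              gsum R 1 (2 ^ l) m2 (2 ^ (i + 2)))))].
Proof.
have kappa_out (l2 : (2 <= l)%N) d := Sigma_gsum R m1 m2 hkl l2 hmu (d := d).
have mu2 n : 1 + mu * 2 ^+ n.+2 = (mu * 2 ^+ n) * 4 + 1.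
  by rewrite !exprS; ring.
split=> [l01 | l2 kl | l2 kl | l2 kl].
(* For l <= 1 the bound [l.-1] is 0, so no admissible i exists and there are no double cosets. *)
- have noS : [set double_coset g | g in SSet (2 ^+ k) (mu * 2 ^+ l)]%classic = set0.
    apply/seteqP; split => // y [g /(SSet_coords hkl hmu)[i [b [x [c [il _ _ _ _]]]]] _].
    by case: l01 il => ->.
  by rewrite /Sigma noS fsbig_set0.
- rewrite (kappa_out l2 1); first last.
  + by rewrite -(subnK (ltnW kl)) addn2 mu2 modzMDl.
  + by left.
  congr (_ * _); apply: eq_bigr => i _.
  by rewrite /kappa !gtn_eqF ?(ltnW kl) // expr1n mul1r.
- rewrite (kappa_out l2 1); first last.
  + by rewrite kl mu2 modzMDl.
  + by left.
  rewrite -mulrA mulrCA; congr (_ * _); rewrite mulr_sumr; apply: eq_bigr => i /eqP hi.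
  by rewrite kl (kappa_expr _ 2 hmu hi) rmorphN1.
(* Here 1 + 2 mu = -1 mod 4 for either sign of mu, which exchanges the two sums in [m2]. *)
- rewrite (kappa_out l2 (-1)); first last.
  + by rewrite kl expr1; case: hmu => ->.
  + by right.
  rewrite -mulrA mulrCA; congr (_ * _); rewrite mulr_sumr; apply: eq_bigr => i /eqP hi.
  by rewrite kl (kappa_expr _ 1 hmu hi) opprK.
Qed.
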